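(* Let $m\ge 2$, $d\ge 1$ and $k\ge 0$ be integers, let \[ \mathbb{P}_m=\det\begin{bmatrix} x_1 & x_1^2 & \cdots & x_1^{2^{m-1}}\\ x_2 & x_2^2 & \cdots & x_2^{2^{m-1}}\\ \vdots & \vdots & \ddots & \vdots\\ x_m & x_m^2 & \cdots & x_m^{2^{m-1}}\end{bmatrix}\in(\mathbb{Z}/2)[x_1,x_2,\ldots,x_m] \] be the Dickson polynomial in $m$ variables, and let $\mathbb{P}_{m-1}(x_2,\ldots,x_m)$ be the Dickson polynomial in the $m-1$ variables $x_2,\ldots,x_m$. If \[ \frac{1}{x_2x_3\cdots x_m}\,\mathbb{P}_{m-1}(x_2,\ldots,x_m)\left(\frac{1}{x_1}\mathbb{P}_m\right)^k\notin (x_1^d,x_2^d,\ldots,x_m^d), \] where the right-hand side is the ideal of $(\mathbb{Z}/2)[x_1,\ldots,x_m]$ generated by $x_1^d,\ldots,x_m^d$, then every mass distribution $\mu$ in $\mathbb{R}^d$ admits an equipartition by a collection of $2k$ parallel hyperplanes and $m-1$ additional non-parallel hyperplanes in $(2k+1)\times 2\times\cdots\times 2$ boxes (with $m-1$ factors $2$); that is, such hyperplanes exist for which each of the $(2k+1)2^{m-1}$ boxes has $\mu$-measure $\frac{1}{(2k+1)2^{m-1}}\mu(\mathbb{R}^d)$.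
   Context: A mass distribution in $\mathbb{R}^d$ is a finite Borel measure $\mu$ of the form $\mu(A)=\int_A f\,dx$ for an integrable density function $f:\mathbb{R}^d\to\mathbb{R}$ (integration with respect to Lebesgue measure), such that every nonempty open subset of $\mathbb{R}^d$ has positive $\mu$-measure. The additional hyperplanes being non-parallel means that none of them is parallel to the hyperplanes of the parallel collection and no two of them are parallel to each other. Boxes: a collection of $l$ parallel hyperplanes divides $\mathbb{R}^d$ into $l+1$ consecutive regions, and each additional hyperplane divides $\mathbb{R}^d$ into two half-spaces; the $(l+1)\times 2\times\cdots\times 2$ boxes are the intersections of one of the $l+1$ regions with one half-space of each of the $m-1$ additional hyperplanes. The Dickson polynomial $\mathbb{P}_{m-1}(x_2,\ldots,x_m)$ is the determinant of the $(m-1)\times(m-1)$ matrix over $(\mathbb{Z}/2)[x_2,\ldots,x_m]$ with rows $(x_i,x_i^2,\ldots,x_i^{2^{m-2}})$, $i=2,\ldots,m$. A Dickson polynomial is the product of all nonzero $\mathbb{Z}/2$-linear combinations of its variables, so it is divisible by the product of its variables, and the quotients above denote polynomials. *)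

(* Defs.v *)
From HB Require Import structures.
From mathcomp Require Import all_boot all_order all_algebra.
From mathcomp Require Import all_classical all_reals all_analysis.
From mathcomp Require Import measurable_realfun.
From mathcomp Require mpoly.
(* Full import is avoided: mpoly's notations and names clash with those of
   mathcomp-analysis. *)
Export (canonicals) mpoly.

Set Implicit Arguments.
Unset Strict Implicit.
Unset Printing Implicit Defensive.

Import Order.TTheory GRing.Theory Num.Theory.
Import numFieldNormedType.Exports.

Local Open Scope classical_set_scope.
Local Open Scope ring_scope.

Definition dickson (A : comNzRingType) (n : nat) (x : 'I_n -> A) : A :=
  \det (\matrix_(i < n, j < n) x i ^+ (2 ^ j)).

Definition in_ideal (A : comNzRingType) (n : nat) (g : 'I_n -> A) (p : A) : Prop :=
  exists a : 'I_n -> A, p = \sum_(i < n) a i * g i.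

(* [exact_quo p q] is p / q when q divides p (and 0 otherwise); it is the only
   such quotient when q != 0, see [exact_quo_unique]. *)
Definition exact_quo (A : idomainType) (p q : A) : A :=
  xget 0 [set r : A | p = r * q].

Lemma exact_quoK (A : idomainType) (p q : A) :
  (exists r, p = r * q) -> p = exact_quo p q * q.
Proof. exact: (@xgetPex _ 0 [set r | p = r * q]). Qed.

Lemma exact_quo_unique (A : idomainType) (r q : A) :
  q != 0 -> exact_quo (r * q) q = r.
Proof. by move=> q0; apply: xget_unique => // s /(mulIf q0). Qed.

Lemma dickson_divides_prod (A : comNzRingType) (n : nat) (x : 'I_n -> A) :
  exists r, dickson x = r * \prod_(i < n) x i.
Proof.
exists (\det (\matrix_(i < n, j < n) x i ^+ (2 ^ j).-1)).
rewrite mulrC.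
have -> : \prod_(i < n) x i = \det (diag_mx (\row_i x i)).
  by rewrite det_diag; apply: eq_bigr => i _; rewrite mxE.
rewrite -det_mulmx; congr (\det _); apply/matrixP => i j.
rewrite mul_diag_mx !mxE -exprS prednK// expn_gt0//.
Qed.

Lemma dickson_divides_var (A : comNzRingType) (n : nat) (x : 'I_n -> A)
    (i : 'I_n) :
  exists r, dickson x = r * x i.
Proof.
have [r ->] := dickson_divides_prod x.
by exists (r * \prod_(j < n | j != i) x j); rewrite (bigD1 i)//= mulrCA mulrC.
Qed.

Definition var (m : nat) (i : 'I_m) : mpoly.mpoly m 'F_2 :=
  mpoly.mpolyX 'F_2 (mpoly.mnm1 i).

Section image_measure.
Context d1 d2 (T1 : measurableType d1) (T2 : measurableType d2) (R : realType).
Variables (mu : {measure set T1 -> \bar R}) (f : T1 -> T2).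
Hypothesis mf : measurable_fun setT f.

(* The proof of measurability is an argument so that the measure structure can
   be inferred. *)
Definition image_measure of measurable_fun setT f := pushforward mu f.

Let im := image_measure mf.

Let mpre A : measurable A -> measurable (f @^-1` A).
Proof. by move=> mA; rewrite -[X in measurable X]setTI; exact: mf. Qed.

Let im0 : im set0 = 0%E.
Proof. by rewrite /im /image_measure /pushforward preimage_set0 measure0. Qed.

Let im_ge0 A : (0 <= im A)%E.
Proof. by rewrite /im /image_measure /pushforward; exact: measure_ge0. Qed.

Let im_sigma_additive : semi_sigma_additive im.
Proof.
move=> F mF tF mUF; rewrite /im /image_measure /pushforward preimage_bigcup.
apply: measure_semi_sigma_additive.
- by move=> i; exact: mpre.
- apply/trivIsetP => /= i j _ _ ij; rewrite -preimage_setI.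
  by move/trivIsetP : tF => /(_ _ _ _ _ ij) ->//; rewrite preimage_set0.
- by rewrite -preimage_bigcup; exact: mpre.
Qed.

HB.instance Definition _ := isMeasure.Build _ _ _ (image_measure mf)
  im0 im_ge0 im_sigma_additive.

End image_measure.

Section lebesgue_tuple.
Context {R : realType}.
Local Notation mR := (measurableTypeR R).

Definition tuple_cons (n : nat) (p : mR * n.-tuple mR) : n.+1.-tuple mR :=
  [tuple of p.1 :: p.2].

Lemma measurable_tuple_cons (n : nat) : measurable_fun setT (@tuple_cons n).
Proof. by apply: measurable_cons; [exact: measurable_fst|exact: measurable_snd]. Qed.

Section cons_measure.
Variables (n : nat) (mu : {sigma_finite_measure set (n.-tuple mR) -> \bar R}).

Definition cons_measure : set (n.+1.-tuple mR) -> \bar R :=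
  image_measure (@lebesgue_measure R \x mu)%E (@measurable_tuple_cons n).

HB.instance Definition _ := Measure.on cons_measure.

Let cons_measure_sigma_finite : sigma_finite setT cons_measure.
Proof.
have /sigma_finiteP[F [FT ndF Foo]] := sigma_finiteT (@lebesgue_measure R).
have /sigma_finiteP[G [GT ndG Goo]] := sigma_finiteT mu.
pose H k (t : n.+1.-tuple mR) := F k (tnth t ord0) /\ G k [tuple of behead t].
exists H => [|k].
  apply/esym; rewrite -subTset => t _.
  have : setT (tnth t ord0) by [].
  rewrite FT => -[i _ Fi].
  have : setT [tuple of behead t] by [].
  rewrite GT => -[j _ Gj].
  exists (maxn i j) => //; split.
    by move: (tnth t ord0) Fi; exact/subsetPset/ndF/leq_maxl.
  by move: [tuple of behead t] Gj; exact/subsetPset/ndG/leq_maxr.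
have [mF Flt] := Foo k; have [mG Glt] := Goo k.
split.
  apply: measurableI.
    by rewrite -[X in measurable X]setTI; exact: (@measurable_tnth _ mR n.+1 ord0).
  by rewrite -[X in measurable X]setTI; exact: (@measurable_behead _ mR n).
rewrite /cons_measure /image_measure /pushforward (_ : _ @^-1` _ = F k `*` G k).
  rewrite [ltLHS](product_measure1E (@lebesgue_measure R) mu mF mG).
  by rewrite lte_mul_pinfty// ge0_fin_numE.
apply/funext => -[x t]; rewrite /preimage /H /setX /=.
by congr (_ /\ G k _); exact/val_inj.
Qed.

HB.instance Definition _ :=
  @Measure_isSigmaFinite.Build _ _ _ cons_measure cons_measure_sigma_finite.

End cons_measure.

Fixpoint lebesgue_tuple (n : nat) :
    {sigma_finite_measure set (n.-tuple mR) -> \bar R} :=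
  match n with
  | 0 => \d_([tuple] : 0.-tuple mR)
  | n'.+1 => cons_measure (lebesgue_tuple n')
  end.

End lebesgue_tuple.

Definition borel_rV (R : realType) (d : nat) :=
  g_sigma_algebraType (@open 'rV[R]_d).

HB.instance Definition _ (R : realType) (d : nat) :=
  Measurable.on (borel_rV R d).

Section lebesgue_rV.
Context {R : realType} {d : nat}.
Local Notation mR := (measurableTypeR R).

Definition rV_of_tuple (t : d.-tuple mR) : borel_rV R d :=
  \row_(i < d) (tnth t i : R).

Lemma open_rV_bigcup_ball (U : set 'rV[R]_d) : open U ->
  U = \bigcup_(q in [set q : 'rV[rat]_d * rat |
        0 < (ratr q.2 : R) /\ ball (map_mx ratr q.1 : 'rV[R]_d) (ratr q.2) `<=` U])
      ball (map_mx ratr q.1 : 'rV[R]_d) (ratr q.2).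
Proof.
move=> oU; apply/seteqP; split=> [x Ux|x [q [_ qU] /qU]//].
have : nbhs x U by apply: open_nbhs_nbhs.
rewrite -nbhs_ballE => -[e /= e0 xeU].
have /rat_in_itvoo[r] : 0 < e / 2 by rewrite divr_gt0.
rewrite in_itv /= => /andP[r0 re].
have xr i : exists q : rat, ratr q \in `](x 0 i - ratr r), (x 0 i + ratr r)[.
  by apply: rat_in_itvoo; rewrite ltrBlDr -addrA ltrDl addr_gt0.
pose q : 'rV[rat]_d := \row_i xchoose (xr i).
have qx : ball (map_mx ratr q : 'rV[R]_d) (ratr r) x.
  split=> // i j; rewrite ord1 !mxE.
  by rewrite /ball/= ltr_distl; have := xchooseP (xr j); rewrite in_itv.
exists (q, r) => //=; split=> // y qy.
apply: xeU; rewrite [e]splitr.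
apply: (@ball_triangle _ _ (map_mx ratr q : 'rV[R]_d)).
  by apply: ball_sym; apply: le_ball qx; exact: ltW.
by apply: le_ball qy; exact: ltW.
Qed.

Lemma measurable_rV_of_tuple : measurable_fun setT rV_of_tuple.
Proof.
apply: (@measurability _ _ _ (borel_rV R d) setT rV_of_tuple (@open _)) => //.
move=> _ [U oU <-]; rewrite setTI (open_rV_bigcup_ball oU) preimage_bigcup.
rewrite bigcup_mkcond; apply: countable_bigcupT_measurable.
  exact: countableP.
move=> [q r]; case: ifPn => //; rewrite inE /= => -[r0 _].
rewrite (_ : _ @^-1` _ = \bigcap_(i in [set: 'I_d])
   ((fun t : d.-tuple mR => tnth t i) @^-1` (ball (ratr (q 0 i) : R) (ratr r)))).
  apply: fin_bigcap_measurable; first exact: finite_finset.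
  move=> i _; rewrite -[X in measurable X]setTI.
  by apply: measurable_tnth => //; exact: measurable_ball.
apply/seteqP; split=> t /=.
  by move=> [_ qt] i _; have := qt 0 i; rewrite !mxE.
by move=> qt; split=> // i j; rewrite ord1 !mxE; exact: qt.
Qed.

Definition lebesgue_rV : {measure set (borel_rV R d) -> \bar R} :=
  image_measure (lebesgue_tuple d) measurable_rV_of_tuple.

End lebesgue_rV.

Definition mass_distribution (R : realType) (d : nat)
    (mu : {measure set (borel_rV R d) -> \bar R}) : Prop :=
  [/\ (mu setT < +oo)%E,
      exists2 f : borel_rV R d -> R,
        lebesgue_rV.-integrable setT (EFin \o f) &
        forall A, measurable A -> mu A = (\int[lebesgue_rV]_(x in A) (f x)%:E)%E
    & forall U : set 'rV[R]_d, open U -> U !=set0 -> (0 < mu U)%E].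

Definition dotv (R : realType) (d : nat) (u x : 'rV[R]_d) : R :=
  \sum_(i < d) u 0 i * x 0 i.

(* The hyperplane {x | dotv normal x = offset}. *)
Record hyperplane (R : realType) (d : nat) := Hyperplane {
  normal : 'rV[R]_d;
  offset : R;
  normal_neq0 : normal != 0
}.

Section boxes.
Context {R : realType} {d : nat}.

Definition parallel (H H' : hyperplane R d) : Prop :=
  exists t : R, normal H = t *: normal H'.

(* Distinct parallel hyperplanes, normalised to share one normal vector and
   listed in increasing order along it. *)
Definition parallel_collection (l : nat) (P : 'I_l -> hyperplane R d) : Prop :=
  (forall i j, normal (P i) = normal (P j)) /\
  (forall i j : 'I_l, (i < j)%N -> offset (P i) < offset (P j)).

(* Closed half-spaces: adjacent boxes share boundary points, which form a null
   set for any mass distribution. *)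
Definition halfspace (H : hyperplane R d) (s : bool) : set 'rV[R]_d :=
  if s then [set x | offset H <= dotv (normal H) x]
       else [set x | dotv (normal H) x <= offset H].

(* The j-th of the l+1 consecutive regions cut out by a parallel collection:
   past the hyperplanes of index < j, before the others. *)
Definition region (l : nat) (P : 'I_l -> hyperplane R d) (j : 'I_l.+1) :
    set 'rV[R]_d :=
  [set x | forall i : 'I_l, halfspace (P i) (i < j)%N x].

Definition box (l n : nat) (P : 'I_l -> hyperplane R d)
    (H : 'I_n -> hyperplane R d) (j : 'I_l.+1) (s : 'I_n -> bool) :
    set 'rV[R]_d :=
  [set x | region P j x /\ forall i : 'I_n, halfspace (H i) (s i) x].

Definition equipartition (mu : {measure set (borel_rV R d) -> \bar R})
    (l n : nat) (P : 'I_l -> hyperplane R d) (H : 'I_n -> hyperplane R d) :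
    Prop :=
  forall (j : 'I_l.+1) (s : 'I_n -> bool),
    mu (box P H j s) = (((l.+1 * 2 ^ n)%N%:R^-1)%:E * mu setT)%E.

End boxes.

(* Main.v *)
(* The normals u_1, ..., u_m of the hyperplanes range over nonzero vectors of
   R^d. They determine the 2k parallel hyperplanes, which cut mu into 2k + 1
   equal slices orthogonal to u_1, and the m - 1 bisecting hyperplanes. The
   masses of the boxes then depend continuously on the u_i, and they are all
   equal if and only if the nontrivial Walsh coefficients of each slice vanish.
   Combining the coefficients of slices that are exchanged by u_1 |-> -u_1
   gives real test functions that change sign according to a nonzero element of
   (Z/2)^m under the involutions u_i |-> -u_i; the product of the corresponding
   linear forms is the polynomial of the theorem, since a Dickson polynomial is
   the product of all nonzero linear forms.

   That such functions have a common zero is a Borsuk-Ulam theorem for products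
   of spheres, proved with cochains. Parametrize the product of upper
   hemispheres by a cube, on the boundary of which antipodal points are
   identified blockwise, and triangulate a fine grid. The signs of a test
   function at the vertices define a mod 2 coboundary that descends to the
   quotient. If there were no common zero, then for a fine enough grid no
   simplex would see all test functions change sign, so the Alexander-Whitney
   product of these cocycles would vanish identically. Its sum over all simplices depends
   only on the sign characters, and a choice of explicit sign functions shows
   that it is the coefficient of a monomial in the product of linear forms. *)

Require Import Defs.
From mathcomp Require Import all_boot all_order all_algebra.
From mathcomp Require Import fingroup perm.
From mathcomp Require Import all_classical all_reals all_analysis.
From mathcomp Require Import measurable_realfun.
From mathcomp Require mpoly.
From mathcomp Require Import zify ring lra.

Set Implicit Arguments.
Unset Strict Implicit.
Unset Printing Implicit Defensive.

Import Order.TTheory GRing.Theory Num.Theory.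
Import numFieldNormedType.Exports.

Local Open Scope classical_set_scope.
Local Open Scope ring_scope.


(** * Cup products on the union jack triangulation of a cube *)

Lemma F2_addxx (x : 'F_2) : x + x = 0.
Proof. by apply: addrr_pchar2; rewrite pchar_Fp. Qed.

Lemma F2_addr_eq0 (x y : 'F_2) : (x + y == 0) = (x == y).
Proof.
apply/eqP/eqP => [h|->]; last exact: F2_addxx.
by rewrite -[x]addr0 -(F2_addxx y) addrA h add0r.
Qed.

(** Terms cancel in pairs over ['F_2]; [enum_rank] selects one representative of each orbit. *)
Lemma sum_involution (T : finType) (g : T -> T) (F : T -> 'F_2) :
  involutive g -> (forall x, g x != x) -> (forall x, F (g x) = F x) ->
  \sum_x F x = 0.
Proof.
move=> gK gx Fg; rewrite (bigID (fun x => enum_rank x < enum_rank (g x))%N)/=.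
rewrite [X in _ + X](reindex_inj (inv_inj gK))/=.
rewrite [X in _ + X](eq_big (fun x => enum_rank x < enum_rank (g x))%N F)//.
  exact: F2_addxx.
move=> x; rewrite gK -leqNgt ltn_neqAle andb_idl// => _.
by rewrite (inj_eq val_inj) (inj_eq enum_rank_inj) eq_sym.
Qed.

Section cup_product.
Context {V : Type}.
Implicit Types (a g : V -> 'F_2) (u v : nat -> V) (G : (nat -> V) -> 'F_2).

(* The Alexander-Whitney product of the 1-cocycles (v, w) |-> a v + a w, for a
   in s, and of the cochain G, on the ordered simplex u. *)
Fixpoint cup (s : seq (V -> 'F_2)) G u : 'F_2 :=
  if s is a :: s' then (a (u 0%N) + a (u 1%N)) * cup s' G (u \o S) else G u.

(** Precomposition with [bump j] omits vertex [j]: this is the mod 2 coboundary on a simplex with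
    [n] vertices. *)
Definition cobd (n : nat) G u : 'F_2 := \sum_(j < n) G (u \o bump j).

Lemma cupE s G u : cup s G u =
  (\prod_(j < size s) (nth (fun=> 0) s j (u j) + nth (fun=> 0) s j (u j.+1)))
  * G (fun n => u (size s + n)%N).
Proof.
elim: s u => [|a s IH] u /=; first by rewrite big_ord0 mul1r.
by rewrite big_ord_recl IH mulrA.
Qed.

Lemma cup_ext s G G' u : (forall v, G v = G' v) -> cup s G u = cup s G' u.
Proof. by move=> GG'; rewrite !cupE GG'. Qed.

Lemma cup_cat s s' G u : cup (s ++ s') G u = cup s (cup s' G) u.
Proof. by elim: s u => //= a s IH u; rewrite IH. Qed.

(** Leibniz rule with closed factors: the coboundary acts on [G] alone. The faces omitting vertices
    0 and 1 share a tail, and their head factors add up to that of the edge from 0 to 1. *)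
Lemma cobd_cup s G n u :
  cobd (size s + n.+2) (cup s G) u = cup s (cobd n.+2 G) u.
Proof.
elim: s u => // a s IH u.
rewrite /= -IH /cobd !addnS /= -addnS.
rewrite big_ord_recl big_ord_recl/= [in RHS]big_ord_recl/= addrA.
rewrite (_ : u \o bump 0 \o S = u \o S \o bump 0); last first.
  by apply/funext => i /=; rewrite /bump/= !add1n.
rewrite (_ : u \o bump (bump 0 0) \o S = u \o S \o bump 0); last first.
  by apply/funext => i /=; rewrite /bump/= !add1n.
rewrite -mulrDl /= /bump/= !add1n !addn0.
rewrite (_ : a (u 1%N) + a (u 2) + (a (u 0%N) + a (u 2)) =
    a (u 0%N) + a (u 1%N)); last first.
  by rewrite addrACA F2_addxx addr0 addrC.
rewrite mulrDr; congr (_ + _); rewrite mulr_sumr; apply: eq_bigr => i _.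
congr (_ * cup _ _ _); apply/funext => j /=.
by rewrite /bump/= !add1n ltnS addnS.
Qed.

(** Hence a product of cocycles with the coboundary of a 0-cochain [g] among its factors is
    exact. *)
Lemma cobd_cup_insert s1 s2 g u :
  cobd (size s1 + size s2 + 2)
    (cup s1 (fun v => g (v 0%N) * cup s2 (fun=> 1) v)) u =
  cup (s1 ++ g :: s2) (fun=> 1) u.
Proof.
rewrite -addnA addn2 cobd_cup cup_cat; apply: cup_ext => v /=.
have h0 : cobd (size s2).+2 (cup s2 (fun=> 1)) v = 0.
  rewrite -(addn2 (size s2)) cobd_cup cupE /cobd big_ord_recl big_ord1.
  by rewrite F2_addxx mulr0.
(* Only the face omitting vertex 0 evaluates [g] at [v 1]; [h0] equates its tail with the sum of the
   other tails. *)
rewrite /cobd big_ord_recl/=.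
rewrite (_ : v \o bump 0 = v \o S); last by apply/funext => i /=; rewrite /bump.
rewrite (eq_bigr (fun i : 'I_(size s2).+1 =>
    g (v 0%N) * cup s2 (fun=> 1) (v \o bump (lift ord0 i)))) => [|//].
rewrite -mulr_sumr mulrDl addrC; congr (_ + _); congr (_ * _); apply/eqP.
move: h0; rewrite /cobd big_ord_recl/=.
rewrite (_ : v \o bump 0 = v \o S); last by apply/funext => i /=; rewrite /bump.
by move=> /eqP; rewrite F2_addr_eq0 eq_sym.
Qed.

End cup_product.

(** * Pairing of faces in the union jack triangulation *)

Section grid.
Context {N m : nat}.
Variables (L : nat) (blk : 'I_N -> 'I_m).
Notation V := ('I_N -> nat).
Implicit Types (a : V -> 'F_2) (v : V).

(* The grid is [{0, ..., 4L}]^N with centre (2L, ..., 2L). *)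
Definition flip (i : 'I_m) (v : V) : V :=
  fun t => if blk t == i then (4 * L - v t)%N else v t.

Definition in_grid v := forall t, (v t <= 4 * L)%N.

Definition on_bd (i : 'I_m) v :=
  exists2 t, blk t = i & v t = 0%N \/ v t = (4 * L)%N.

Definition equivariant (x : 'I_m -> 'F_2) a :=
  forall i v, in_grid v -> on_bd i v -> a (flip i v) = a v + x i.

Definition even_end (w : nat) := (w + odd w)%N.
Definition odd_end (w : nat) := (w + ~~ odd w)%N.

Notation cell := ({ffun 'I_N -> 'I_(4 * L)} * 'S_N)%type.

(* The coordinate t of the unit cube w moves from its even end to its odd end
   at time p t, so the vertices below span a simplex of the union jack
   triangulation, which is invariant under the flips. *)
Definition vtx (c : cell) (j : nat) : V :=
  fun t => if (c.2 t < j)%N then odd_end (c.1 t) else even_end (c.1 t).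

Lemma vtx_grid c j : in_grid (vtx c j).
Proof.
move=> t; rewrite /vtx /odd_end /even_end; have := ltn_ord (c.1 t).
have : ~~ odd (4 * L) by rewrite oddM.
by case: ifP => _; lia.
Qed.

Definition setw (w : {ffun 'I_N -> 'I_(4 * L)}) (t0 : 'I_N) (x : 'I_(4 * L)) :=
  [ffun t => if t == t0 then x else w t].

(** The unit interval across the odd end, which always exists as 0 and [4 * L] are even. *)
Definition oflip (x : 'I_(4 * L)) : 'I_(4 * L) :=
  insubd x (if odd x then x.-1 else x.+1).

(** The unit interval across the even end. An [extremal] interval has no such neighbour and is left
    fixed. *)
Definition eflip (x : 'I_(4 * L)) : 'I_(4 * L) :=
  insubd x (if odd x then x.+1 else x.-1).

Definition extremal (x : 'I_(4 * L)) := (x == 0 :> nat) || (x.+1 == 4 * L)%N.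

Lemma val_oflip x : oflip x = (if odd x then x.-1 else x.+1) :> nat.
Proof.
rewrite /oflip val_insubd; case: ifP => // /negbT.
by have := ltn_ord x; case: ifP; lia.
Qed.

Lemma val_eflip x : ~~ extremal x -> eflip x = (if odd x then x.+1 else x.-1) :> nat.
Proof.
rewrite /extremal /eflip val_insubd => xe; case: ifP => // /negbT.
by have := ltn_ord x; case: ifP; lia.
Qed.

Lemma oflipK x : oflip (oflip x) = x.
Proof.
apply/val_inj; rewrite /= !val_oflip.
by case: (boolP (odd x)) => ox; case: ifP; lia.
Qed.

Lemma extremal_eflip x : ~~ extremal x -> ~~ extremal (eflip x).
Proof.
move=> xe; move: (xe) (ltn_ord x); rewrite /extremal val_eflip//.
by case: ifP; lia.
Qed.

Lemma eflipK x : ~~ extremal x -> eflip (eflip x) = x.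
Proof.
move=> xe; apply/val_inj; rewrite /= val_eflip ?extremal_eflip// val_eflip//.
move: xe (ltn_ord x); rewrite /extremal.
by case: (boolP (odd x)) => ox; case: ifP; lia.
Qed.

Lemma oflip_neq x : oflip x != x.
Proof.
by apply/eqP => /(congr1 val); rewrite /= val_oflip; case: ifP; lia.
Qed.

Lemma eflip_neq x : ~~ extremal x -> eflip x != x.
Proof.
move=> xe; apply/eqP => /(congr1 val); rewrite /= val_eflip//.
by move: xe; rewrite /extremal; case: ifP; lia.
Qed.

Lemma odd_end_oflip x : odd_end (oflip x) = odd_end x.
Proof. by rewrite /odd_end val_oflip; case: (boolP (odd x)); lia. Qed.

Lemma even_end_eflip x : ~~ extremal x -> even_end (eflip x) = even_end x.
Proof.
move=> xe; rewrite /even_end val_eflip//; move: xe; rewrite /extremal.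
by case: (boolP (odd x)); lia.
Qed.

Lemma setwE w t0 x t : setw w t0 x t = if t == t0 then x else w t.
Proof. by rewrite ffunE. Qed.

Definition rev_blk (w : {ffun 'I_N -> 'I_(4 * L)}) (i : 'I_m) :=
  [ffun t => if blk t == i then rev_ord (w t) else w t].

(** A flip preserves parity because [4 * L] is even, so even ends go to even ends and the order of
    moves is kept. *)
Lemma vtx_rev_blk w p i j : vtx (rev_blk w i, p) j = flip i (vtx (w, p) j).
Proof.
apply/funext => t; rewrite /vtx /flip /= ffunE.
rewrite /odd_end /even_end; have := ltn_ord (w t).
by case: ifP => _; case: ifP => _ /=; lia.
Qed.

Variable H : (nat -> V) -> 'F_2.

Hypothesis H_ext : forall u v : nat -> V,
  (forall j, (j < N)%N -> u j = v j) -> H u = H v.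

Hypothesis H_flip : forall i (u : nat -> V),
  (forall j, (j < N)%N -> in_grid (u j) /\ on_bd i (u j)) ->
  H (fun j => flip i (u j)) = H u.

(** The coordinate that moves first stays at its odd end on this face, which is shared with the cube
    across that end. *)
Lemma first_face_sum (n0 : 'I_N) : n0 = 0%N :> nat ->
  \sum_c H (vtx c \o bump 0) = 0.
Proof.
move=> n00.
pose t0 (p : 'S_N) := (p^-1)%g n0.
pose g (c : cell) : cell := (setw c.1 (t0 c.2) (oflip (c.1 (t0 c.2))), c.2).
apply: (@sum_involution _ g) => [[w p]|[w p]|[w p]]; rewrite /g /=.
- congr (_, _); apply/ffunP => t; rewrite !setwE eqxx.
  by case: eqP => // ->; rewrite oflipK.
- apply/eqP => -[] /ffunP /(_ (t0 p)); rewrite setwE eqxx; exact/eqP/oflip_neq.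
- apply: H_ext => j jN; apply/funext => t; rewrite /= /vtx /= setwE.
  case: eqP => // ->; rewrite /t0 permKV n00 /bump /=.
  by rewrite odd_end_oflip.
Qed.

(** Without the vertex between two consecutive moves, their order is invisible, so exchanging them
    keeps the face. *)
Lemma inner_face_sum (c1 c2 : 'I_N) : c2 = c1.+1 :> nat ->
  \sum_c H (vtx c \o bump c2) = 0.
Proof.
move=> c12.
pose g (c : cell) : cell := (c.1, (c.2 * tperm c1 c2)%g).
apply: (@sum_involution _ g) => [[w p]|[w p]|[w p]]; rewrite /g /=.
- by rewrite -mulgA tperm2 mulg1.
- apply/eqP => -[] /permP /(_ ((p^-1)%g c1)); rewrite permM permKV tpermL.
  by move/(congr1 val) => /=; lia.
- apply: H_ext => j jN; apply/funext => t; rewrite /= /vtx /= permM.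
  congr (if _ then _ else _); rewrite /bump.
  by case: tpermP => [->|->|]//; lia.
Qed.

(** The coordinate that moves last stays at its even end. If that end is interior, the face is
    shared with the cube across it; otherwise the face is on the boundary and is paired with its
    image under a flip. *)
Lemma last_face_sum (n0 : 'I_N) : N = n0.+1 ->
  \sum_c H (vtx c \o bump N) = 0.
Proof.
move=> Nn0.
pose t0 (p : 'S_N) := (p^-1)%g n0.
pose g (c : cell) : cell :=
  if extremal (c.1 (t0 c.2)) then (rev_blk c.1 (blk (t0 c.2)), c.2)
  else (setw c.1 (t0 c.2) (eflip (c.1 (t0 c.2))), c.2).
apply: (@sum_involution _ g) => [[w p]|[w p]|[w p]]; rewrite /g /=.
- have [xe|xe] := boolP (extremal (w (t0 p))) => /=; rewrite ffunE eqxx.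
    have -> : extremal (rev_ord (w (t0 p))).
      by move: xe; rewrite /extremal /=; have := ltn_ord (w (t0 p)); lia.
    congr (_, _); apply/ffunP => t; rewrite !ffunE.
    by case: ifPn => [->|/negbTE ->]; rewrite ?rev_ordK.
  rewrite (negbTE (extremal_eflip xe)); congr (_, _); apply/ffunP => t.
  by rewrite !setwE; case: eqP => // ->; rewrite eflipK.
- have [xe|xe] := boolP (extremal (w (t0 p))) => /=.
    apply/eqP => -[] /ffunP /(_ (t0 p)); rewrite ffunE eqxx.
    move=> /(congr1 val) /=.
    by have := ltn_ord (w (t0 p)); lia.
  apply/eqP => -[] /ffunP /(_ (t0 p)); rewrite setwE eqxx; exact/eqP/eflip_neq.
- have bumpN j : (j < N)%N -> bump N j = j by move=> jN; rewrite /bump; lia.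
  have tj j : (j < N)%N -> (p (t0 p) < j)%N = false.
    by move=> jN; rewrite /t0 permKV; lia.
  have [xe|xe] := boolP (extremal (w (t0 p))) => /=.
    rewrite -(H_flip (i := blk (t0 p)) (u := vtx (w, p) \o bump N)).
      apply: H_ext => j jN /=; rewrite vtx_rev_blk; apply/funext => t.
      rewrite /flip; have := vtx_grid (w, p) (bump N j) t.
      by case: ifP => // _ h; rewrite subKn.
    move=> j jN /=; rewrite bumpN//; split; first exact: vtx_grid.
    exists (t0 p) => //; rewrite /vtx /= tj//.
    move: xe; rewrite /extremal /even_end /=.
    by have := ltn_ord (w (t0 p)); lia.
  apply: H_ext => j jN /=; rewrite bumpN//; apply/funext => t.
  rewrite /vtx /= setwE; case: eqP => // ->; rewrite tj// even_end_eflip//.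
Qed.

Lemma face_sum (c : nat) : (0 < N)%N -> (c <= N)%N ->
  \sum_f H (vtx f \o bump c) = 0.
Proof.
move=> N0 cN; case: c => [|c] in cN *; first exact: (@first_face_sum (Ordinal N0)).
move: cN; rewrite leq_eqVlt => /predU1P[cN|cN].
  by rewrite cN; apply: (@last_face_sum (Ordinal (_ : (c < N)%N))); rewrite -cN.
exact: (@inner_face_sum (Ordinal (ltnW cN)) (Ordinal cN)).
Qed.

End grid.

(** * Evaluation of cup products on the whole grid *)

Section grid_sum.
Context {N m : nat}.
Variables (L : nat) (blk : 'I_N -> 'I_m).
Notation V := ('I_N -> nat).
Notation equiv := (equivariant L blk).

Definition grid_sum (s : seq (V -> 'F_2)) : 'F_2 :=
  \sum_c cup s (fun=> 1) (@vtx N L c).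

(** The function [a + a'] is invariant under boundary flips, so it is a 0-cochain on the quotient;
    the two products differ by an exact cochain, whose sum over all simplices is 0. *)
Lemma grid_sum_insert (s1 s2 : seq (V -> 'F_2)) (x : 'I_m -> 'F_2)
    (a a' : V -> 'F_2) :
  (size s1 + size s2).+1 = N ->
  (forall b, b \in s1 ++ s2 -> exists x, equiv x b) ->
  equiv x a -> equiv x a' ->
  grid_sum (s1 ++ a :: s2) = grid_sum (s1 ++ a' :: s2).
Proof.
move=> sN sx xa xa'; pose g v := a v + a' v.
apply/eqP; rewrite -F2_addr_eq0 /grid_sum -big_split/=; apply/eqP.
transitivity (\sum_(c : {ffun 'I_N -> 'I_(4 * L)} * 'S_N)
    cup (s1 ++ g :: s2) (fun=> 1) (vtx c)).
  apply: eq_bigr => c _; rewrite !cup_cat ![cup s1 _ _]cupE -mulrDr; congr (_ * _).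
  rewrite /= -mulrDl; congr (_ * _).
  by rewrite /g addrACA.
under eq_bigr do rewrite -cobd_cup_insert.
rewrite /cobd exchange_big/=; apply: big1 => c _.
apply: (face_sum (blk := blk)); last 2 first.
- by move: sN; lia.
- by move: sN (ltn_ord c); lia.
- move=> u v uv; rewrite !cupE; congr (_ * (_ * _)).
  + apply: eq_bigr => j _.
    by rewrite !uv//; have := ltn_ord j; move: sN; lia.
  + by rewrite uv//; move: sN; lia.
  + congr (_ * _); apply: eq_bigr => j _ /=.
    by rewrite !uv//; have := ltn_ord j; move: sN; lia.
- have nth_s s j : {subset s <= s1 ++ s2} -> (j < size s)%N ->
    exists x, equiv x (nth (fun=> 0) s j).
    by move=> ss js; apply: sx; apply: ss; rewrite mem_nth.
  have s1s : {subset s1 <= s1 ++ s2} by move=> b; rewrite mem_cat => ->.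
  have s2s : {subset s2 <= s1 ++ s2} by move=> b; rewrite mem_cat orbC => ->.
  move=> i u ui; rewrite !cupE; congr (_ * (_ * _)).
  + apply: eq_bigr => j _; have [y ey] := nth_s s1 j s1s (ltn_ord j).
    have [|g0 b0] := ui j; first by have := ltn_ord j; move: sN; lia.
    have [|g1 b1] := ui j.+1; first by have := ltn_ord j; move: sN; lia.
    by rewrite !ey// addrACA F2_addxx addr0.
  + have [|g0 b0] := ui (size s1 + 0)%N; first by move: sN; lia.
    by rewrite /g xa// xa'// addrACA F2_addxx addr0.
  + congr (_ * _); apply: eq_bigr => j _ /=.
    have [y ey] := nth_s s2 j s2s (ltn_ord j).
    have [|g0 b0] := ui (size s1 + j)%N; first by have := ltn_ord j; move: sN; lia.
    have [|g1 b1] := ui (size s1 + j.+1)%N; first by have := ltn_ord j; move: sN; lia.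
    by rewrite !ey// addrACA F2_addxx addr0.
Qed.

Lemma grid_sum_eq (x : 'I_N -> 'I_m -> 'F_2) (a a' : 'I_N -> V -> 'F_2) :
  (forall c, equiv (x c) (a c)) -> (forall c, equiv (x c) (a' c)) ->
  grid_sum (map a (enum 'I_N)) = grid_sum (map a' (enum 'I_N)).
Proof.
move=> xa xa'.
(* Factors are exchanged one by one; those in [s1] are already switched to [a']. *)
suff h s1 s2 : s1 ++ s2 = enum 'I_N ->
    grid_sum (map a' s1 ++ map a s2) = grid_sum (map a' (s1 ++ s2)).
  by rewrite -(h [::] (enum 'I_N)).
elim: s2 s1 => [|c s2 IH] s1 ss; first by rewrite /= !cats0.
rewrite -cat_rcons -IH ?cat_rcons// /= map_rcons cat_rcons.
apply: (@grid_sum_insert _ _ (x c)) => //.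
  rewrite !size_map; have := congr1 size ss.
  by rewrite size_cat size_enum_ord/= addnS.
move=> b; rewrite mem_cat => /orP[] /mapP[c' _ ->]; first by exists (x c').
by exists (x c').
Qed.

Lemma grid_sumE (a : 'I_N -> V -> 'F_2) :
  grid_sum (map a (enum 'I_N)) =
  \sum_f \prod_(c < N) (a c (@vtx N L f c) + a c (vtx f c.+1)).
Proof.
apply: eq_bigr => f _; rewrite cupE mulr1.
rewrite size_map size_enum_ord; apply: eq_bigr => c _.
by rewrite (nth_map c) ?size_enum_ord// nth_ord_enum.
Qed.

(** The sign of the first off-centre coordinate of block [i], with default 0 at the centre of the
    block. *)
Definition lex_sign (i : 'I_m) (v : V) : 'F_2 :=
  if [pick t | (blk t == i) && (v t != 2 * L)%N] is Some t
  then (v t < 2 * L)%N%:R else 0.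

Lemma flip_lt (w : nat) : (w <= 4 * L)%N -> w != (2 * L)%N ->
  (4 * L - w < 2 * L)%N%:R = (w < 2 * L)%N%:R + 1 :> 'F_2.
Proof.
move=> h1 h2; have -> : (4 * L - w < 2 * L)%N = ~~ (w < 2 * L)%N by lia.
by case: ltnP => _ /=; rewrite ?add0r// F2_addxx.
Qed.

Lemma lex_sign_equiv i : (0 < L)%N -> equiv (fun j => (j == i)%:R) (lex_sign i).
Proof.
move=> L0 j v gv [t tj vt]; rewrite /lex_sign.
have eqp : [pick t | (blk t == i) && (flip L blk j v t != 2 * L)%N] =
    [pick t | (blk t == i) && (v t != 2 * L)%N].
  apply: eq_pick => t' /=; rewrite /flip; have := gv t'.
  by case: ifP => // _; case: (blk t' == i) => //=; lia.
rewrite eqp; case: pickP => [s /andP[/eqP si vs]|h].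
  by rewrite /flip si; have [_|_] := eqVneq j i; rewrite ?flip_lt ?addr0.
have [ji|ji] := eqVneq j i; last by rewrite addr0.
have := h t; rewrite tj ji eqxx/=.
by case: vt; lia.
Qed.

Lemma sum_lex_sign_equiv (x : 'I_m -> 'F_2) : (0 < L)%N ->
  equiv x (fun v => \sum_i x i * lex_sign i v).
Proof.
move=> L0 i v gv bv; rewrite [in LHS](eq_bigr (fun j =>
    x j * lex_sign j v + x j * (i == j)%:R)); last first.
  by move=> j _; rewrite lex_sign_equiv// mulrDr.
rewrite big_split/=; congr (_ + _).
rewrite (bigD1 i)//= eqxx mulr1 big1 ?addr0// => j ji.
by rewrite eq_sym (negbTE ji) mulr0.
Qed.

(** Each factor can be replaced by a combination of lexicographic signs with the same character; the
    product then expands over all choices [f]. *)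
Lemma grid_sum_expand (x : 'I_N -> 'I_m -> 'F_2) (a : 'I_N -> V -> 'F_2) :
  (0 < L)%N -> (forall c, equiv (x c) (a c)) ->
  grid_sum (map a (enum 'I_N)) =
  \sum_(f : {ffun 'I_N -> 'I_m}) (\prod_c x c (f c)) *
    grid_sum (map (fun c => lex_sign (f c)) (enum 'I_N)).
Proof.
move=> L0 xa.
rewrite (@grid_sum_eq x _ (fun c v => \sum_i x c i * lex_sign i v))//; last first.
  by move=> c; exact: sum_lex_sign_equiv.
rewrite grid_sumE [RHS](eq_bigr (fun f : {ffun 'I_N -> 'I_m} =>
  \sum_g \prod_(c < N) (x c (f c) *
   (lex_sign (f c) (@vtx N L g c) + lex_sign (f c) (vtx g c.+1))))); last first.
  move=> f _; rewrite grid_sumE mulr_sumr; apply: eq_bigr => g _.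
  by rewrite big_split.
rewrite exchange_big/=; apply: eq_bigr => g _.
rewrite -(bigA_distr_bigA (fun c j => x c j *
  (lex_sign j (@vtx N L g c) + lex_sign j (vtx g c.+1)))).
apply: eq_bigr => c _; rewrite -big_split/=.
by apply: eq_bigr => j _; rewrite mulrDr.
Qed.

(** The monomial given by [f] then has, in each variable, the dimension of the corresponding block
    as its degree. *)
Definition balanced (f : 'I_N -> 'I_m) :=
  [forall i, #|[pred c | f c == i]| == #|[pred t | blk t == i]|].

Lemma balanced_perm (f : 'I_N -> 'I_m) :
  reflect (exists p : 'S_N, forall c, blk (p c) = f c) (balanced f).
Proof.
have cnt (h : 'I_N -> 'I_m) i :
    count_mem i [tuple h c | c < N] = #|[pred c | h c == i]|.
  rewrite [RHS]cardE {1}/enum_mem size_filter -enumT /= count_map.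
  exact: eq_count.
apply: (iffP idP) => [/forallP bf|[p pf]].
  have /tuple_permP[p pE] : perm_eq [tuple f c | c < N] [tuple blk c | c < N].
    by apply/allP => i _ /=; rewrite !cnt; exact: bf.
  exists p => c; have := congr1 (fun s => tnth s c) (val_inj pE).
  by rewrite !tnth_mktuple => ->.
apply/forallP => i; apply/eqP.
rewrite -(fintype.card_image (@perm_inj _ p)); apply: eq_card => t; rewrite !inE.
apply/fintype.imageP/idP => [[c]|/eqP ti].
  by rewrite inE => /eqP <- ->; rewrite pf.
by exists (p^-1 t)%g; rewrite ?inE ?permKV// -pf permKV ti.
Qed.

Lemma lex_sign_ext i v v' :
  (forall t, blk t = i -> v t = v' t) -> lex_sign i v = lex_sign i v'.
Proof.
move=> vv; rewrite /lex_sign.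
have -> : [pick t | (blk t == i) && (v t != 2 * L)%N] =
    [pick t | (blk t == i) && (v' t != 2 * L)%N].
  by apply: eq_pick => t /=; case: eqP => //= /vv ->.
by case: pickP => // t /andP[/eqP/vv ->].
Qed.

(** Move [c] of a simplex changes a single coordinate. If sign [f c] changes with it, that
    coordinate is in block [f c], so a contributing simplex matches [f] with [blk]. *)
Lemma grid_sum_unbalanced (f : 'I_N -> 'I_m) : ~~ balanced f ->
  grid_sum (map (fun c => lex_sign (f c)) (enum 'I_N)) = 0.
Proof.
apply: contraNeq; rewrite grid_sumE => /eqP h.
have [g gP] : exists g, \prod_(c < N)
    (lex_sign (f c) (@vtx N L g c) + lex_sign (f c) (vtx g c.+1)) != 0.
  apply: contrapT => /forallNP hg; apply: h; apply: big1 => g _.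
  by apply/eqP; have /negP := hg g; rewrite negbK.
apply/balanced_perm; exists (g.2^-1)%g => c; apply: contrapT => /eqP fc.
move: gP; rewrite prodf_seq_neq0 => /allP /(_ c (mem_index_enum _)) /=.
rewrite F2_addr_eq0 => /eqP; apply; apply: lex_sign_ext => t tc.
rewrite /vtx; suff : g.2 t != c :> nat 
  by move=> ?; have -> : (g.2 t < c.+1)%N = (g.2 t < c)%N by lia.
apply: contra fc => /eqP gt; rewrite -tc; apply/eqP; congr blk.
by apply: (@perm_inj _ g.2); rewrite permKV; apply/val_inj.
Qed.

Lemma perm_ge_id (p : 'S_N) : (forall c : 'I_N, c <= p c)%N -> forall c, p c = c.
Proof.
move=> pc; have sum_eq : \sum_(c < N) (p c - c)%N = 0%N.
  have : (\sum_(c < N) c = \sum_(c < N) ((p c - c) + c))%N.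
    by rewrite (reindex_perm p); apply: eq_bigr => c _; rewrite subnK.
  by move/eqP; rewrite big_split/= -[X in X == _]add0n eqn_add2r => /eqP.
move=> c; apply/val_inj; move/eqP: sum_eq.
rewrite sum_nat_eq0 => /forallP /(_ c) /=; have := pc c.
lia.
Qed.

(** The signs are replaced by others with the same characters, the [c]-th one reading coordinate
    [q c] when it is off-centre. The sum then has one nonzero term. *)
Lemma grid_sum_balanced (f : 'I_N -> 'I_m) : (0 < L)%N -> balanced f ->
  grid_sum (map (fun c => lex_sign (f c)) (enum 'I_N)) = 1.
Proof.
move=> L0 /balanced_perm[q qf].
(* Near the centre the tie-break is 0, so that only one simplex contributes. *)
pose a c v : 'F_2 := if v (q c) != (2 * L)%N then (v (q c) < 2 * L)%N%:R else
  if `[< on_bd L blk (f c) v >] then lex_sign (f c) v else 0.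
rewrite (@grid_sum_eq (fun c j => (j == f c)%:R) _ a); last 2 first.
- by move=> c; exact: lex_sign_equiv.
- move=> c i v gv bv; rewrite /a.
  have -> : (flip L blk i v (q c) != 2 * L)%N = (v (q c) != 2 * L)%N.
    by rewrite /flip; have := gv (q c); case: ifP => // _; lia.
  case: ifPn => [vq|vq].
    rewrite /flip qf; have [_|_] := eqVneq i (f c); last by rewrite addr0.
    by rewrite flip_lt.
  have -> : `[< on_bd L blk (f c) (flip L blk i v) >] =
            `[< on_bd L blk (f c) v >].
    apply: asbool_equiv_eq; split=> -[t tc vt]; exists t => //.
      by move: vt (gv t); rewrite /flip; case: ifP => _; lia.
    by move: vt (gv t); rewrite /flip; case: ifP => _; lia.
  case: asboolP => [_|fv]; first by rewrite lex_sign_equiv.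
  have [ic|_] := eqVneq i (f c); last by rewrite addr0.
  by rewrite ic in bv.
have w0P : ((2 * L).-1 < 4 * L)%N by lia.
(* Coordinate [q c] moves at time [c] from the even point [2 * L] down to [(2 * L).-1], changing its
   sign from 0 to 1. *)
pose c0 : {ffun 'I_N -> 'I_(4 * L)} * 'S_N :=
  ([ffun=> Ordinal w0P], (q^-1)%g).
rewrite grid_sumE (bigD1 c0)//= [X in _ + X]big1 ?addr0.
  apply: big1 => c _.
  have v1 : vtx c0 c (q c) = (2 * L)%N.
    by rewrite /vtx /= ffunE permK ltnn /even_end /=; lia.
  have v2 : vtx c0 c.+1 (q c) = (2 * L).-1%N.
    by rewrite /vtx /= ffunE permK ltnSn /odd_end /=; lia.
  have nbd : ~ on_bd L blk (f c) (vtx c0 c).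
    move=> [t _]; rewrite /vtx /= ffunE /even_end /odd_end /=.
    by case: ifP; lia.
  rewrite /a v1 eqxx/= asboolF// v2.
  have -> : ((2 * L).-1 != 2 * L)%N by lia.
  have -> : ((2 * L).-1 < 2 * L)%N by lia.
  by rewrite add0r.
move=> [w p]; apply: contraNeq; rewrite prodf_seq_neq0 => /allP h.
have {}h c : a c (vtx (w, p) c) != a c (vtx (w, p) c.+1).
  by have := h c (mem_index_enum _); rewrite /= F2_addr_eq0.
(* A coordinate [q c] that moved before time [c] would be at the same odd point at both vertices,
   and the sign would not change. *)
have pq : (q * p = 1)%g.
  apply/permP => c; rewrite perm1; apply: perm_ge_id => {}c.
  rewrite permM leqNgt; apply/negP => pc; have /negP := h c; apply.
  have v1 : vtx (w, p) c (q c) = odd_end (w (q c)) by rewrite /vtx /= pc.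
  have v2 : vtx (w, p) c.+1 (q c) = odd_end (w (q c)).
    by rewrite /vtx /= ltnS ltnW.
  have o : odd_end (w (q c)) != (2 * L)%N by rewrite /odd_end; lia.
  by rewrite /a v1 v2 o.
have pqc c : p (q c) = c by rewrite -permM pq perm1.
have w1 (c : 'I_N) : vtx (w, p) c (q c) = even_end (w (q c)).
  by rewrite /vtx /= pqc ltnn.
have w2 (c : 'I_N) : vtx (w, p) c.+1 (q c) = odd_end (w (q c)).
  by rewrite /vtx /= pqc ltnSn.
have ev (c : 'I_N) : even_end (w (q c)) = (2 * L)%N.
  apply/eqP; apply: contraT => ne; have := h c; rewrite /a w1 w2 ne.
  have -> : odd_end (w (q c)) != (2 * L)%N by rewrite /odd_end; lia.
  have -> : (even_end (w (q c)) < 2 * L)%N = (odd_end (w (q c)) < 2 * L)%N.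
    by move: ne; rewrite /even_end /odd_end; case: (boolP (odd _)); lia.
  by rewrite eqxx.
have evt t : even_end (w t) = (2 * L)%N.
  by rewrite -(permKV q t) ev.
apply/eqP; congr (_, _); last first.
  by rewrite -[p]mul1g -(mulVg q) -mulgA pq mulg1.
apply/ffunP => t; rewrite ffunE; apply/val_inj => /=.
rewrite -(permKV q t); set c := (q^-1)%g t.
have nbd : ~ on_bd L blk (f c) (vtx (w, p) c).
  move=> [s _]; rewrite /vtx /=; have := evt s.
  by rewrite /even_end /odd_end; case: ifP => _; case: (boolP (odd (w s))); lia.
(* The tie-break gives sign 0 at the centre, so the move must go below it, which determines the
   cube. *)
have := h c; rewrite /a w1 ev eqxx/= asboolF// w2.
have -> : odd_end (w (q c)) != (2 * L)%N by rewrite /odd_end; lia.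
have := ev c; rewrite /even_end /odd_end.
by case: (boolP (odd (w (q c)))) => o; case: ltnP => //=; lia.
Qed.

(** The sum is the coefficient, in the product of the linear forms given by [x c], of the monomial
    whose degrees are the block dimensions. It equals [grid_sum], so some simplex contributes when
    it is nonzero. *)
Theorem grid_path (x : 'I_N -> 'I_m -> 'F_2) (a : 'I_N -> V -> 'F_2) :
  (0 < L)%N -> (forall c, equiv (x c) (a c)) ->
  \sum_(f : {ffun 'I_N -> 'I_m} | balanced f) \prod_c x c (f c) != 0 ->
  exists g, forall c : 'I_N, a c (@vtx N L g c) != a c (vtx g c.+1).
Proof.
move=> L0 xa s0; apply: contrapT => /forallNP h; move/eqP: s0; apply.
transitivity (grid_sum (map a (enum 'I_N))).
  rewrite (grid_sum_expand L0 xa).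
  rewrite [RHS](bigID (fun f : {ffun 'I_N -> 'I_m} => balanced f))/=.
  rewrite [X in _ = _ + X]big1 ?addr0.
    by apply: eq_bigr => f bf; rewrite grid_sum_balanced ?mulr1.
  by move=> f bf; rewrite grid_sum_unbalanced ?mulr0.
rewrite grid_sumE; apply: big1 => g _.
have /existsNP[c /negP] := h g; rewrite negbK => /eqP ac.
by rewrite (bigD1 c)//= ac F2_addxx mul0r.
Qed.

End grid_sum.

(** * Borsuk-Ulam theorem for products of spheres *)

Lemma cvg_rV (R : realType) (n : nat) (T : Type) (F : set_system T)
    {FF : Filter F} (f : T -> 'rV[R]_n) (l : 'rV[R]_n) :
  (forall i, (fun t => f t 0 i) @ F --> l 0 i) -> f @ F --> l.
Proof.
move=> fl; apply/cvg_ballP => e e0; near=> t; split=> // i j; rewrite ord1.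
move: j; near: t; apply: filter_forall => j.
by have /cvg_ballP := fl j; apply.
Unshelve. all: by end_near. Qed.

Lemma cvg_rV_coord (R : realType) (n : nat) (T : Type) (F : set_system T)
    {FF : Filter F} (f : T -> 'rV[R]_n) (l : 'rV[R]_n) (i : 'I_n) :
  f @ F --> l -> (fun t => f t 0 i) @ F --> l 0 i.
Proof.
move=> fl; apply: (cvg_comp f (fun M : 'rV[R]_n => M 0 i) fl).
exact: coord_continuous.
Qed.

Lemma cvg_sum_fin (R : realType) (I : Type) (r : seq I) (P : pred I) (T : Type)
    (F : set_system T) {FF : Filter F} (f : I -> T -> R) (l : I -> R) :
  (forall i, P i -> f i @ F --> l i) ->
  (fun t => \sum_(i <- r | P i) f i t) @ F --> \sum_(i <- r | P i) l i.
Proof. by apply: cvg_big; exact: add_continuous. Qed.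

Lemma cvg_prod_fin (R : realType) (I : Type) (r : seq I) (P : pred I) (T : Type)
    (F : set_system T) {FF : Filter F} (f : I -> T -> R) (l : I -> R) :
  (forall i, P i -> f i @ F --> l i) ->
  (fun t => \prod_(i <- r | P i) f i t) @ F --> \prod_(i <- r | P i) l i.
Proof. by apply: cvg_big; exact: mul_continuous. Qed.

Definition negate_at (V : zmodType) (I : eqType) (i : I) (u : I -> V) : I -> V :=
  fun j => if j == i then - u j else u j.

Section borsuk_ulam.
Context {R : realType} {m d N : nat}.
Variables (blk : 'I_N -> 'I_m) (pos : 'I_N -> 'I_d) (deg : 'I_m -> 'I_d).
Hypothesis pos_lt : forall t, (pos t < deg (blk t))%N.
Hypothesis pos_inj : forall t t', blk t = blk t' -> pos t = pos t' -> t = t'.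

(* Maps the cube [-1, 1]^N to tuples of nonzero vectors; the block i of a point
   of the cube is sent to an upper hemisphere of dimension deg i, with
   antipodal points of its boundary going to opposite vectors. *)
Definition hemi (y : 'rV[R]_N) (i : 'I_m) : 'rV[R]_d :=
  \row_j (\sum_(t | (blk t == i) && (pos t == j)) y 0 t +
          (j == deg i)%:R * \prod_(t | blk t == i) (1 - y 0 t ^+ 2)).

(** If the product vanishes, some coordinate of the block is 1 or -1 and, by injectivity of [pos],
    is not added to another one. Otherwise entry [deg i] is nonzero, since [pos_lt] keeps the
    coordinates out of it. *)
Lemma hemi_neq0 y i : hemi y i != 0.
Proof.
apply/eqP => /rowP h0.
have [p0|/negP p0] := boolP (\prod_(t | blk t == i) (1 - y 0 t ^+ 2) == 0).
  have /prodf_eq0[t ti] := p0; rewrite subr_eq0 eq_sym sqrf_eq1 => yt.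
  have := h0 (pos t); rewrite !mxE (eqP p0) mulr0 addr0.
  rewrite (bigD1 t) ?ti ?eqxx//= big1 ?addr0; last first.
    move=> t' /andP[/andP[/eqP ti' /eqP pt']] /negP; case.
    by apply/eqP/pos_inj => //; rewrite ti' (eqP ti).
  by move=> y0; move: yt; rewrite y0 eq_sym oner_eq0 eq_sym oppr_eq0 oner_eq0.
have := h0 (deg i); rewrite !mxE eqxx mul1r big1 ?add0r; first by move/eqP.
move=> t /andP[/eqP ti /eqP pt]; have := pos_lt t.
by rewrite pt ti ltnn.
Qed.

Lemma hemi_continuous i : continuous (hemi ^~ i).
Proof.
move=> y; apply: (@cvg_rV R d _ (nbhs y) _ (hemi ^~ i)) => j.
rewrite [X in _ --> X]mxE.
under eq_fun do rewrite mxE.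
apply: cvgD.
  apply: (@cvg_sum_fin _ _ _ _ _ (nbhs y) _ (fun t (z : 'rV[R]_N) => z 0 t)) => t _.
  exact: coord_continuous.
apply: cvgM; first exact: cvg_cst.
apply: (@cvg_prod_fin _ _ _ _ _ (nbhs y) _
  (fun t (z : 'rV[R]_N) => 1 - z 0 t ^+ 2)) => t _.
apply: cvgB; first exact: cvg_cst.
by apply: cvgM; exact: coord_continuous.
Qed.

Section zero.
Variables (chi : 'I_N -> {set 'I_m}) (f : 'I_N -> ('I_m -> 'rV[R]_d) -> R).
Hypothesis f_cvg : forall c (U : 'rV[R]_N -> 'I_m -> 'rV[R]_d) (y : 'rV[R]_N),
  (forall i, U y i != 0) -> (forall i, U z i @[z --> y] --> U y i) ->
  f c (U z) @[z --> y] --> f c (U y).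
Hypothesis f_negate : forall c i u, (forall j, u j != 0) ->
  f c (negate_at i u) = (-1) ^+ (i \in chi c) * f c u.

Definition grid_pt (L : nat) (v : 'I_N -> nat) : 'rV[R]_N :=
  \row_t ((v t)%:R / (2 * L)%:R - 1).

Lemma grid_pt_flip L i v : (0 < L)%N -> in_grid L v ->
  grid_pt L (flip L blk i v) =
  \row_t (if blk t == i then - grid_pt L v 0 t else grid_pt L v 0 t).
Proof.
move=> L0 gv; apply/rowP => t; rewrite !mxE /flip; case: ifP => // _.
rewrite natrB ?gv// (_ : 4 * L = 2 * (2 * L))%N; last by lia.
have h : (2 * L)%:R != 0 :> R by rewrite pnatr_eq0; lia.
by rewrite [(2 * _)%:R in LHS]natrM mulrBl mulfK//; ring.
Qed.

(** On the boundary of block [i] the product in entry [deg i] vanishes, and the remaining linear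
    part changes sign with the coordinates. *)
Lemma hemi_grid_flip L i v : (0 < L)%N -> in_grid L v -> on_bd L blk i v ->
  hemi (grid_pt L (flip L blk i v)) = negate_at i (hemi (grid_pt L v)).
Proof.
move=> L0 gv [t ti vt]; rewrite grid_pt_flip//; apply/funext => j.
rewrite /negate_at; apply/rowP => l; have [->{j}|ji] := eqVneq j i.
  rewrite !mxE opprD; congr (_ + _).
    rewrite -sumrN; apply: eq_bigr => s /andP[si _].
    by rewrite [in LHS]mxE si.
  suff p0 : \prod_(s | blk s == i) (1 - grid_pt L v 0 s ^+ 2) = 0.
    rewrite p0 (eq_bigr (fun s => 1 - grid_pt L v 0 s ^+ 2)) => [|s si].
      by rewrite p0 mulr0 oppr0.
    by rewrite mxE si sqrrN.
  apply/eqP/prodf_eq0; exists t; first exact/eqP.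
  have h : (2 * L)%:R != 0 :> R by rewrite pnatr_eq0; lia.
  rewrite mxE; case: vt => ->; first by rewrite mul0r sub0r sqrrN expr1n subrr.
  rewrite (_ : 4 * L = 2 * (2 * L))%N; last by lia.
  by rewrite [(2 * (2 * _))%:R]natrM mulfK//; apply/eqP; ring.
rewrite !mxE; congr (_ + _ * _).
  apply: eq_bigr => s /andP[/eqP si _].
  by rewrite [in LHS]mxE si (negbTE ji).
apply: eq_bigr => s /eqP si.
by rewrite [in LHS]mxE si (negbTE ji).
Qed.

(** Where the test function vanishes, a combination of lexicographic signs with the same character
    keeps the sign equivariant. *)
Definition grid_sign (L : nat) (c : 'I_N) (v : 'I_N -> nat) : 'F_2 :=
  if f c (hemi (grid_pt L v)) == 0
  then \sum_i (i \in chi c)%:R * lex_sign L blk i v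
  else (f c (hemi (grid_pt L v)) < 0)%R%:R.

Lemma grid_sign_equiv L c : (0 < L)%N ->
  equivariant L blk (fun i => (i \in chi c)%:R) (grid_sign L c).
Proof.
move=> L0 i v gv bv; rewrite /grid_sign hemi_grid_flip// f_negate; last first.
  by move=> j; exact: hemi_neq0.
rewrite mulf_eq0 signr_eq0/=; case: ifPn => [_|f0].
  exact: sum_lex_sign_equiv.
case: (i \in chi c) => /=; last by rewrite expr0 mul1r addr0.
rewrite expr1 mulN1r oppr_lt0.
by case: ltrgt0P f0 => //= _ _; rewrite ?add0r ?F2_addxx.
Qed.

Lemma grid_pt_vtx_dist L g j j' t : (0 < L)%N ->
  `|grid_pt L (@vtx N L g j) 0 t - grid_pt L (vtx g j') 0 t| <= L%:R^-1.
Proof.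
move=> L0; rewrite !mxE opprB addrA subrK -mulrBl normrM normfV.
have L0' : 0 < L%:R :> R by rewrite ltr0n.
rewrite [X in _ / X]ger0_norm// natrM invfM mulrA ler_piMl ?invr_ge0 ?ler0n//.
rewrite ler_pdivrMr// mul1r.
apply: (@le_trans _ _ 1); last by rewrite (ler_nat _ 1 2).
rewrite /vtx /odd_end /even_end; case: ifP => _; case: ifP => _;
  rewrite ?subrr ?normr0 ?ler01// !natrD opprD addrACA subrr add0r;
  case: odd => /=; rewrite ?subr0 ?sub0r ?normrN ?normr1//.
Qed.

Theorem product_borsuk_ulam :
  \sum_(h : {ffun 'I_N -> 'I_m} | balanced blk h)
    \prod_c (h c \in chi c)%:R != 0 :> 'F_2 ->
  exists u, (forall i, u i != 0) /\ forall c, f c u = 0.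
Proof.
move=> s0; apply: contrapT => /forallNP nz.
pose cube := [set y : 'rV[R]_N | forall t, `[-1, 1]%classic (y 0 t)].
have cube_compact : compact cube.
  apply: (@rV_compact R N (fun=> `[-1, 1]%classic)) => t.
  exact: segment_compact.
(* On every grid some simplex sees all signs change; its vertex 0 is followed as the mesh tends to
   0. *)
have gP n : {g | forall c : 'I_N,
    grid_sign n.+1 c (@vtx N n.+1 g c) != grid_sign n.+1 c (vtx g c.+1)}.
  by apply: cid; apply: grid_path s0 => // c; exact: grid_sign_equiv.
pose z n := grid_pt n.+1 (@vtx N n.+1 (projT1 (gP n)) 0).
have [y [_ yz]] : cube `&` cluster (z @ \oo) !=set0.
  apply: cube_compact; exists 0%N => // n _ t /=; rewrite in_itv/= /z !mxE.
  have h0 : 0 < (2 * n.+1)%:R :> R by rewrite ltr0n.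
  rewrite lerBDr addNr divr_ge0 ?ler0n//=.
  rewrite lerBlDr ler_pdivrMr// -(natrD _ 1 1) -natrM ler_nat.
  by apply: (leq_trans (vtx_grid _ _ _)); lia.
(* Without a common zero, some test function is nonzero at the cluster point [y], so its sign is
   constant nearby. *)
have [c fy] : exists c, f c (hemi y) != 0.
  apply: contrapT => /forallNP fy; apply: (nz (hemi y)); split.
    by move=> i; exact: hemi_neq0.
  by move=> c; have /negP := fy c; rewrite negbK => /eqP.
have fc : f c (hemi x) @[x --> y] --> f c (hemi y).
  by apply: f_cvg => i; [exact: hemi_neq0|exact: hemi_continuous].
have [e e0 ye] : exists2 e : R, 0 < e & forall x, ball y e x ->
    f c (hemi x) != 0 /\ (f c (hemi x) < 0) = (f c (hemi y) < 0).
  suff : \forall x \near y,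
      f c (hemi x) != 0 /\ (f c (hemi x) < 0) = (f c (hemi y) < 0).
    by move/nbhs_ballP => [e e0 he]; exists e.
  case: (ltrgt0P (f c (hemi y))) fy => // f0 _.
    near=> x; have : 0 < f c (hemi x).
      by near: x; exact: (cvgr_gt (f c (hemi y))).
    by move=> h; rewrite gt_eqF// lt_gtF.
  near=> x; have h : f c (hemi x) < 0.
    by near: x; exact: (cvgr_lt (f c (hemi y))).
  by rewrite lt_eqF// h.
have e20 : 0 < e / 2 by rewrite divr_gt0.
have near_z : (z @ \oo) [set x | exists2 n, x = z n & n.+1%:R^-1 < e / 2].
  have [K _ KP] := near_infty_natSinv_lt (PosNum e20).
  by exists K => // n Kn; exists n => //; exact: KP.
have [x [[n -> ne] yx]] := yz _ _ near_z (nbhsx_ballx y (e / 2) e20).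
(* The simplex is smaller than [e / 2], so all of it lies in the ball where [f c] keeps its sign,
   although its sign changes along edge [c]. *)
have vb j : ball y e (grid_pt n.+1 (vtx (projT1 (gP n)) j)).
  rewrite [e]splitr; apply: ball_triangle yx _; split => // i t.
  rewrite ord1 /ball/=; apply: le_lt_trans ne.
  exact: grid_pt_vtx_dist.
have /negP := projT2 (gP n) c; apply; rewrite /grid_sign.
have [h1 h2] := ye _ (vb c); have [h3 h4] := ye _ (vb c.+1).
by rewrite (negbTE h1) (negbTE h3) h2 h4.
Unshelve. all: by end_near. Qed.

End zero.

End borsuk_ulam.

(** * Dickson polynomials and monomial ideals *)

Lemma big_set_lift (A : Type) (idx : A) (op : Monoid.com_law idx) (n : nat)
    (k : 'I_n.+1) (F : {set 'I_n.+1} -> A) :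
  \big[op/idx]_(s : {set 'I_n.+1}) F s =
  op (\big[op/idx]_(s : {set 'I_n}) F (lift k @: s)%SET)
     (\big[op/idx]_(s : {set 'I_n}) F (k |: lift k @: s)%SET).
Proof.
have kl (s : {set 'I_n}) : k \notin (lift k @: s)%SET.
  by apply/imsetP => -[i _ /eqP]; rewrite (negbTE (neq_lift k i)).
have lK (s : {set 'I_n}) : (lift k @^-1: (lift k @: s) = s)%SET.
  by apply/finset.setP => i; rewrite inE mem_imset//; exact: lift_inj.
have lK' (s : {set 'I_n.+1}) : k \notin s ->
    (lift k @: (lift k @^-1: s) = s)%SET.
  move=> ks; apply/finset.setP => i; apply/imsetP/idP => [[j]|si].
    by rewrite inE => js ->.
  have [ik|ik] := eqVneq k i; first by rewrite -ik (negbTE ks) in si.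
  by have [j ij _] := unlift_some ik; exists j => //; rewrite inE -ij.
rewrite (bigID (fun s : {set 'I_n.+1} => k \notin s))/=; congr (op _ _).
  rewrite (reindex_onto (fun s : {set 'I_n} => (lift k @: s)%SET)
     (fun s => (lift k @^-1: s)%SET)) => [|s ks]; last exact: lK'.
  by apply: eq_bigl => s; rewrite kl lK eqxx.
rewrite (reindex_onto (fun s : {set 'I_n} => (k |: lift k @: s)%SET)
   (fun s => (lift k @^-1: (s :\ k))%SET)) => [|s ks].
  apply: eq_bigl => s; rewrite finset.setU11/=; apply/eqP.
  suff -> : ((k |: lift k @: s) :\ k = lift k @: s)%SET by [].
  apply/finset.setP => i; rewrite !inE.
  by case: eqP => //= ->; rewrite (negbTE (kl s)).
by rewrite lK' ?finset.setD11// finset.setD1K//; move: ks; rewrite negbK.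
Qed.

Section dickson_product.
Context {A : comNzRingType}.
Hypothesis charA : 2%:R = 0 :> A.

Definition lin_form (n : nat) (x : 'I_n -> A) (s : {set 'I_n}) : A :=
  \sum_(i in s) x i.

Lemma lin_form_lift n (x : 'I_n.+1 -> A) (k : 'I_n.+1) (s : {set 'I_n}) :
  lin_form x (lift k @: s)%SET = lin_form (x \o lift k) s.
Proof. by rewrite /lin_form big_imset//= => i j _ _; exact: lift_inj. Qed.

Lemma lin_form_liftU n (x : 'I_n.+1 -> A) (k : 'I_n.+1) (s : {set 'I_n}) :
  lin_form x (k |: lift k @: s)%SET = x k + lin_form (x \o lift k) s.
Proof.
rewrite -lin_form_lift /lin_form big_setU1//=.
by apply/imsetP => -[i _ /eqP]; rewrite (negbTE (neq_lift k i)).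
Qed.

(** As a polynomial in [z], it is monic with the F_2-span of the [x i] as roots: the additive
    polynomial of that span. *)
Definition additive_poly (n : nat) (x : 'I_n -> A) (z : A) : A :=
  \prod_(s : {set 'I_n}) (z + lin_form x s).

Lemma sqrrD2 (y z : A) : (y + z) ^+ 2 = y ^+ 2 + z ^+ 2.
Proof. by rewrite sqrrD -mulr_natr charA mulr0 addr0. Qed.

Lemma sqrr_sum (I : Type) (r : seq I) (F : I -> A) :
  (\sum_(i <- r) F i) ^+ 2 = \sum_(i <- r) F i ^+ 2.
Proof.
elim: r => [|i r IH]; first by rewrite !big_nil expr0n.
by rewrite !big_cons sqrrD2 IH.
Qed.

Lemma exprD2n (y z : A) j : (y + z) ^+ (2 ^ j) = y ^+ (2 ^ j) + z ^+ (2 ^ j).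
Proof. by elim: j => [|j IH]; rewrite ?expr1// expnSr !exprM IH sqrrD2. Qed.

(** A further variable [y] turns P(z) into P(z) P(z + y), which by additivity of P is P(z)^2 + P(y)
    P(z); again only the exponents 2^j occur. *)
Lemma additive_polyE n (x : 'I_n -> A) : exists c : nat -> A,
  c n = 1 /\ forall z, additive_poly x z = \sum_(j < n.+1) c j * z ^+ (2 ^ j).
Proof.
elim: n x => [|n IH] x.
  exists (fun=> 1); split=> // z; rewrite big_ord1 mul1r expr1.
  rewrite /additive_poly (bigD1 finset.set0)//= big1 ?mulr1.
    by rewrite /lin_form big_set0 addr0.
  by move=> s; apply: contraNeq => _; apply/eqP/finset.setP => -[].
have [c [cn cE]] := IH (x \o lift ord_max).
pose e := additive_poly (x \o lift ord_max) (x ord_max).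
have stepE z : additive_poly x z = additive_poly (x \o lift ord_max) z ^+ 2 +
    e * additive_poly (x \o lift ord_max) z.
  have addE y z' : additive_poly (x \o lift ord_max) (y + z') =
      additive_poly (x \o lift ord_max) y + additive_poly (x \o lift ord_max) z'.
    rewrite !cE -big_split/=; apply: eq_bigr => j _.
    by rewrite exprD2n mulrDr.
  rewrite expr2 -mulrDl -addE mulrC.
  rewrite {1}/additive_poly (big_set_lift _ ord_max); congr (_ * _).
    by apply: eq_bigr => s _; rewrite lin_form_lift.
  by apply: eq_bigr => s _; rewrite lin_form_liftU addrA.
pose c' j := (if j is j'.+1 then c j' ^+ 2 else 0) +
             (if (j <= n)%N then e * c j else 0).
exists c'; split; first by rewrite /c' cn expr1n ltnn addr0.
move=> z; rewrite stepE !cE sqrr_sum mulr_sumr /c'.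
under [RHS]eq_bigr do rewrite mulrDl.
rewrite [RHS]big_split/=; congr (_ + _).
  rewrite [RHS]big_ord_recl mul0r add0r; apply: eq_bigr => j _.
  by rewrite exprMn -exprM lift0/= -expnSr.
rewrite [RHS]big_ord_recr/= ltnn mul0r addr0; apply: eq_bigr => j _.
by rewrite -ltnS ltn_ord mulrA.
Qed.

(** A unitriangular column operation [U] turns the last column into the values of the additive
    polynomial of the other variables, which vanish in all rows but the last. *)
Lemma dickson_rec n (x : 'I_n.+1 -> A) : dickson x =
  dickson (x \o lift ord_max) * additive_poly (x \o lift ord_max) (x ord_max).
Proof.
have [c [cn cE]] := additive_polyE (x \o lift ord_max).
set M := \matrix_(i < n.+1, j < n.+1) x i ^+ (2 ^ j).
pose U : 'M[A]_n.+1 :=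
  \matrix_(j, l) (if l == ord_max then c j else (j == l)%:R).
have detU : \det U = 1.
  rewrite -det_tr det_trig; last first.
    apply/is_trig_mxP => i j ij; rewrite !mxE.
    case: eqP => [im|_]; last by rewrite gt_eqF.
    by move: ij (ltn_ord j); rewrite im /=; lia.
  by rewrite big1// => i _; rewrite !mxE eqxx; case: eqP => // ->.
have col_max i : (M *m U) i ord_max = additive_poly (x \o lift ord_max) (x i).
  by rewrite cE mxE; apply: eq_bigr => j _; rewrite !mxE eqxx mulrC.
have col_lt i j : (M *m U) i (lift ord_max j) = x i ^+ (2 ^ j).
  rewrite mxE (bigD1 (lift ord_max j))//= big1 ?addr0.
    by rewrite !mxE eq_sym (negbTE (neq_lift _ _)) eqxx mulr1 lift_max.
  move=> l lj; rewrite !mxE [_ == ord_max]eq_sym (negbTE (neq_lift _ _)).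
  by rewrite (negbTE lj) mulr0.
rewrite /dickson -/M -[LHS]mulr1 -detU -det_mulmx (expand_det_col _ ord_max).
rewrite (bigD1 ord_max)//= [X in _ + X]big1 ?addr0.
  rewrite col_max mulrC /cofactor addnn -signr_odd odd_double mul1r.
  by congr (\det _ * _); apply/matrixP => i j; rewrite !mxE -col_lt mxE.
move=> i; rewrite eq_sym => im; rewrite col_max; have [i' -> _] := unlift_some im.
rewrite (_ : additive_poly _ _ = 0) ?mul0r//; apply/eqP.
rewrite /additive_poly (bigD1 [set i']%SET)//= {1}/lin_form big_set1/=.
by rewrite -mulr2n -mulr_natr charA mulr0 mul0r.
Qed.

Lemma dickson_prod n (x : 'I_n -> A) :
  dickson x = \prod_(s : {set 'I_n} | s != finset.set0) lin_form x s.
Proof.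
elim: n x => [|n IH] x.
  rewrite /dickson det_mx00 big1// => s /negP; case.
  by apply/eqP/finset.setP => -[].
rewrite dickson_rec IH [RHS]big_mkcond (big_set_lift _ ord_max)/=.
congr (_ * _).
  rewrite [LHS]big_mkcond; apply: eq_bigr => s _.
  by rewrite imset_eq0 lin_form_lift.
apply: eq_bigr => s _; rewrite lin_form_liftU ifT//.
by apply/finset.set0Pn; exists ord_max; rewrite finset.setU11.
Qed.

(** Forms are grouped by whether they contain variable [k]. Splitting off the form [x k] exhibits
    the quotient by it. *)
Lemma dickson_lift n (x : 'I_n.+1 -> A) (k : 'I_n.+1) : dickson x =
  (\prod_(s : {set 'I_n} | s != finset.set0) (lin_form (x \o lift k) s *
    (x k + lin_form (x \o lift k) s))) * x k.
Proof.
rewrite dickson_prod big_mkcond (big_set_lift _ k)/= big_split/= -mulrA.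
congr (_ * _).
  rewrite [RHS]big_mkcond; apply: eq_bigr => s _.
  by rewrite imset_eq0 lin_form_lift.
rewrite (bigD1 finset.set0)//= mulrC; congr (_ * _).
  apply: eq_bigr => s _; rewrite lin_form_liftU ifT//.
  by apply/finset.set0Pn; exists k; rewrite finset.setU11.
rewrite lin_form_liftU /lin_form big_set0 addr0 ifT//.
by apply/finset.set0Pn; exists k; rewrite finset.setU11.
Qed.

(** The singletons contribute the variables, so the forms in at least two variables make up the
    quotient. *)
Lemma dickson_vars n (x : 'I_n -> A) : dickson x =
  (\prod_(s : {set 'I_n} | (1 < #|s|)%N) lin_form x s) * \prod_i x i.
Proof.
rewrite dickson_prod (bigID (fun s : {set 'I_n} => 1 < #|s|)%N)/=.
congr (_ * _).
  by apply: eq_bigl => s; rewrite -card_gt0; case: #|s| => [|[]].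
rewrite [RHS](_ : _ = \prod_i lin_form x [set i]%SET); last first.
  by apply: eq_bigr => i _; rewrite /lin_form finset.big_set1.
rewrite -(big_imset (lin_form x) (h := fun i : 'I_n => [set i]%SET)
  (A := 'I_n))/=; last by move=> i j _ _; exact: finset.set1_inj.
apply: eq_bigl => s; apply/andP/imsetP => [[s0 s1]|[i _ ->]].
  have /cards1P[i ->] : #|s| == 1.
    by move: s0 s1; rewrite -card_gt0; case: #|s| => [|[]].
  by exists i.
by rewrite -card_gt0 cards1.
Qed.

End dickson_product.

(** * Ideal membership and odd coefficients *)

Section ideal.
Context {A : comNzRingType} {m : nat}.
Implicit Types g : 'I_m -> A.

Lemma in_ideal0 g : in_ideal g 0.
Proof. by exists (fun=> 0); rewrite big1// => i _; rewrite mul0r. Qed.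

Lemma in_idealD g p q : in_ideal g p -> in_ideal g q -> in_ideal g (p + q).
Proof.
move=> [a ->] [b ->]; exists (fun i => a i + b i).
by rewrite -big_split/=; apply: eq_bigr => i _; rewrite mulrDl.
Qed.

Lemma in_ideal_gen g i p : in_ideal g (p * g i).
Proof.
exists (fun j => if j == i then p else 0).
rewrite (bigD1 i)//= eqxx big1 ?addr0// => j /negbTE ->.
by rewrite mul0r.
Qed.

(** Monomials with an exponent at least [d] lie in the ideal, so some monomial with all exponents
    below [d] has an odd coefficient; [a] is its exponent vector. *)
Lemma odd_monomial (d N : nat) (x : 'I_m -> A) (chi : 'I_N -> {set 'I_m}) :
  2%:R = 0 :> A ->
  ~ in_ideal (fun i => x i ^+ d) (\prod_c lin_form x (chi c)) ->
  exists a : 'I_m -> nat, (forall i, a i < d)%N /\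
    \sum_(h : {ffun 'I_N -> 'I_m} | [forall i, #|[pred c | h c == i]| == a i])
      \prod_c (h c \in chi c)%:R != 0 :> 'F_2.
Proof.
move=> charA; apply: contra_notP => /forallNP noa.
(* Weights are natural numbers, so that their sums can be cast both to [A] and to ['F_2]. *)
pose w (h : {ffun 'I_N -> 'I_m}) := (\prod_c (h c \in chi c))%N.
pose cnt (h : {ffun 'I_N -> 'I_m}) : {ffun 'I_m -> 'I_N.+1} :=
  [ffun i => inord #|[pred c | h c == i]|].
have cntE h i : cnt h i = #|[pred c | h c == i]| :> nat.
  rewrite ffunE inordK// ltnS -[leqRHS](card_ord N); exact: max_card.
have -> : \prod_c lin_form x (chi c) =
    \sum_(h : {ffun 'I_N -> 'I_m}) (w h)%:R * \prod_i x i ^+ cnt h i.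
  rewrite [LHS](eq_bigr (fun c => \sum_i (i \in chi c)%:R * x i)).
    rewrite (bigA_distr_bigA (fun c i => (i \in chi c)%:R * x i)).
    apply: eq_bigr => h _; rewrite big_split/= natr_prod; congr (_ * _).
    rewrite (partition_big h xpredT)//=; apply: eq_bigr => i _.
    rewrite cntE -prodr_const; apply: eq_bigr => c.
    by move=> /eqP ->.
  move=> c _; rewrite /lin_form big_mkcond; apply: eq_bigr => i _.
  by case: (i \in chi c); rewrite ?mul1r ?mul0r.
rewrite (partition_big cnt xpredT)//=.
apply: (big_ind (in_ideal _)); [exact: in_ideal0|exact: in_idealD|move=> a _].
rewrite (eq_bigr (fun h : {ffun 'I_N -> 'I_m} =>
    (w h)%:R * \prod_i x i ^+ a i)); last first.
  by move=> h /eqP <-.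
rewrite -mulr_suml -natr_sum.
have [/forallP ad|] := boolP [forall i, a i < d]%N; last first.
  rewrite negb_forall => /existsP[i]; rewrite -leqNgt => ai.
  rewrite (bigD1 i)//= -{1}(subnK ai) exprD.
  set W := _%:R; set Q := \prod_(_ | _) _.
  rewrite (_ : W * _ = W * x i ^+ (a i - d) * Q * x i ^+ d); last by ring.
  exact: (in_ideal_gen (fun i => x i ^+ d)).
rewrite (_ : _%:R = 0) ?mul0r; first exact: in_ideal0.
have : (\sum_(h | cnt h == a) w h)%N%:R = 0 :> 'F_2.
  have /not_andP[//|/negP] := noa (fun i => a i); rewrite negbK => /eqP <-.
  rewrite natr_sum; apply: eq_big => h; last by move=> _; rewrite natr_prod.
  apply/eqP/forallP => [<- i|hi]; first by rewrite cntE.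
  by apply/ffunP => i; apply/val_inj; rewrite /= cntE (eqP (hi i)).
move/eqP; rewrite -(dvdn_pcharf (pchar_Fp (isT : prime 2))) => /dvdnP[q ->].
by rewrite natrM charA mulr0.
Qed.

End ideal.

(* If A is a polynomial ring over F_2 with variables x_i, the quotient by the
   ideal is the cohomology ring of (RP^(d-1))^m, and the product of the linear
   forms is the Euler class that obstructs the existence of nonvanishing maps. *)
Theorem ideal_borsuk_ulam (R : realType) (A : comNzRingType) (m d N : nat)
    (x : 'I_m -> A) (chi : 'I_N -> {set 'I_m})
    (f : 'I_N -> ('I_m -> 'rV[R]_d) -> R) :
  2%:R = 0 :> A ->
  ~ in_ideal (fun i => x i ^+ d) (\prod_c lin_form x (chi c)) ->
  (forall c (U : 'rV[R]_N -> 'I_m -> 'rV[R]_d) (y : 'rV[R]_N),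
    (forall i, U y i != 0) -> (forall i, U z i @[z --> y] --> U y i) ->
    f c (U z) @[z --> y] --> f c (U y)) ->
  (forall c i u, (forall j, u j != 0) ->
    f c (negate_at i u) = (-1) ^+ (i \in chi c) * f c u) ->
  exists u, (forall i, u i != 0) /\ forall c, f c u = 0.
Proof.
move=> charA xI f_cvg f_neg.
have [a [ad s0]] := odd_monomial charA xI.
(* The pairs in [T] index the cube coordinates: block [i] has dimension [a i], and its hemisphere
   fits because [a i < d]. *)
pose T := [set p : 'I_m * 'I_d | (p.2 < a p.1)%N]%SET.
have cardT i : #|[pred p in T | p.1 == i]| = a i.
  rewrite -[RHS]card_ord -(card_imset _ (f := fun j : 'I_(a i) =>
    (i, widen_ord (ltnW (ad i)) j))); last first.
    by move=> j k /= [jk]; apply/val_inj.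
  apply: eq_card => -[i' j]; rewrite !inE/=.
  apply/andP/imsetP => [[ji /eqP ii]|[k _ [-> ->]]]; last by rewrite eqxx/=.
  rewrite ii in ji; exists (Ordinal ji) => //; rewrite ii; congr (_, _).
  exact/val_inj.
(* Some [h] has fibres of sizes [a i], so there are as many cube coordinates as test functions. *)
have NT : N = #|T|.
  have [h /forallP hP] : exists h : {ffun 'I_N -> 'I_m},
      [forall i, #|[pred c | h c == i]| == a i].
    apply: contrapT => /forallNP nh; move/eqP: s0; apply; apply: big1 => h hP.
    by have := nh h.
  rewrite -[LHS]card_ord -!sum1_card (partition_big h xpredT)//=.
  rewrite (partition_big (fun p => p.1) xpredT)//=; apply: eq_bigr => i _.
  rewrite !sum1_card; have := hP i => /eqP hi.
  by rewrite -[LHS]/(#|[pred c | h c == i]|) hi -cardT.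
subst N.
pose blk (t : 'I_#|T|) := (enum_val t).1.
pose pos (t : 'I_#|T|) := (enum_val t).2.
have balE (h : {ffun 'I_#|T| -> 'I_m}) :
    balanced blk h = [forall i, #|[pred c | h c == i]| == a i].
  apply: eq_forallb => i; congr (_ == _).
  rewrite -cardT -(card_imset _ (@enum_val_inj _ T)); apply: eq_card => p.
  rewrite !inE; apply/imsetP/andP => [[t + ->]|[pT pi]].
    by rewrite inE => ti; have := enum_valP t; rewrite inE.
  have pT' : p \in T by rewrite inE.
  by exists (enum_rank_in pT' p); rewrite ?inE ?/blk enum_rankK_in.
apply: (@product_borsuk_ulam R m d _ blk pos (fun i => Ordinal (ad i)) _ _ chi).
- by move=> t; have := enum_valP t; rewrite inE.
- move=> t t' bb pp; apply: enum_val_inj; move: bb pp; rewrite /blk /pos.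
  by case: (enum_val t) (enum_val t') => [? ?] [? ?] /= -> ->.
- exact: f_cvg.
- exact: f_neg.
- by rewrite (eq_bigl _ _ balE).
Qed.

(** * Mass of half-spaces *)

Section real_measure.
Context {d : measure_display} {T : measurableType d} {R : realType}.
Variable mu : {measure set T -> \bar R}.
Hypothesis mu_fin : (mu setT < +oo)%E.

Definition rmeas (A : set T) : R := fine (mu A).

Lemma measure_fin A : measurable A -> mu A \is a fin_num.
Proof.
move=> mA; rewrite ge0_fin_numE//; apply: le_lt_trans mu_fin.
by apply: le_measure; rewrite ?inE.
Qed.

Lemma rmeasE A : measurable A -> mu A = (rmeas A)%:E.
Proof. by move=> mA; rewrite fineK// measure_fin. Qed.

Lemma rmeas_ge0 A : 0 <= rmeas A.
Proof. exact: fine_ge0. Qed.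

Lemma le_rmeas A B : measurable A -> measurable B -> A `<=` B ->
  rmeas A <= rmeas B.
Proof.
move=> mA mB AB; rewrite -lee_fin -!rmeasE//.
by apply: le_measure; rewrite ?inE.
Qed.

Lemma rmeas0 : rmeas set0 = 0.
Proof. by rewrite /rmeas measure0. Qed.

Lemma rmeasU A B : measurable A -> measurable B -> A `&` B = set0 ->
  rmeas (A `|` B) = rmeas A + rmeas B.
Proof.
move=> mA mB AB; apply: EFin_inj; rewrite EFinD -!rmeasE//; last exact: measurableU.
exact: measureU.
Qed.

Lemma rmeasDI A B : measurable A -> measurable B ->
  rmeas A = rmeas (A `\` B) + rmeas (A `&` B).
Proof.
move=> mA mB; apply: EFin_inj; rewrite EFinD -!rmeasE//.
- exact: measureDI.
- exact: measurableI.
- exact: measurableD.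
Qed.

Lemma rmeasC A : measurable A -> rmeas (~` A) = rmeas setT - rmeas A.
Proof.
by move=> mA; rewrite (rmeasDI measurableT mA) setTD setTI addrK.
Qed.

Lemma rmeasU_le A B : measurable A -> measurable B ->
  rmeas (A `|` B) <= rmeas A + rmeas B.
Proof.
move=> mA mB; rewrite -lee_fin EFinD -!rmeasE//; last exact: measurableU.
exact: measureU2.
Qed.

Lemma rmeas_bigcup_le (I : finType) (F : I -> set T) :
  (forall i, measurable (F i)) ->
  rmeas (\bigcup_i F i) <= \sum_i rmeas (F i).
Proof.
move=> mF.
suff h (s : seq I) : measurable (\bigcup_(i in [set` s]) F i) /\
    rmeas (\bigcup_(i in [set` s]) F i) <= \sum_(i <- s) rmeas (F i).
  have [_] := h (index_enum I); rewrite (_ : [set` index_enum I] = setT)//.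
  by apply/seteqP; split=> // i _ /=; exact: mem_index_enum.
elim: s => [|i s [ms IH]].
  rewrite (_ : \bigcup_(i in _) _ = set0) ?rmeas0 ?big_nil//.
  by apply/seteqP; split=> // x [].
have -> : \bigcup_(j in [set` i :: s]) F j =
    F i `|` \bigcup_(j in [set` s]) F j.
  apply/seteqP; split=> x.
    move=> [j /=]; rewrite inE => /predU1P[->|js] Fx; first by left.
    by right; exists j.
  move=> [Fx|[j js Fx]]; [exists i|exists j] => //=.
    exact: mem_head.
  by rewrite inE js orbT.
split; first exact: measurableU.
by rewrite big_cons (le_trans (rmeasU_le _ _))// lerD2l.
Qed.

Lemma rmeas_bigcup (I : finType) (Q : pred I) (F : I -> set T) :
  (forall i, measurable (F i)) ->
  (forall i j, F i `&` F j !=set0 -> i = j) ->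
  rmeas (\bigcup_(i in [set` Q]) F i) = \sum_(i | Q i) rmeas (F i).
Proof.
move=> mF tF; rewrite /rmeas measure_fin_bigcup//; last first.
  by move=> i j _ _; exact: tF.
rewrite -(@bigfs _ _ _ _ (index_enum I))//=; last 2 first.
- exact: index_enum_uniq.
- by move=> i _; rewrite mem_index_enum.
by rewrite -sum_fine// => i _; exact: measure_fin.
Qed.

Lemma rmeas_decr_lt (F : (set T)^nat) (e : R) :
  (forall n, measurable (F n)) -> (forall n m, (n <= m)%N -> F m `<=` F n) ->
  mu (\bigcap_n F n) = 0%E -> 0 < e -> exists n, rmeas (F n) < e.
Proof.
move=> mF dF F0 e0.
have /fine_cvg /cvgr_lt /(_ _ e0) [n _ nP] : (mu \o F) @ \oo --> 0%:E.
  have -> : 0%:E = mu (\bigcap_n F n) by rewrite F0.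
  apply: nonincreasing_cvg_mu => //.
  - by rewrite -ge0_fin_numE// measure_fin.
  - exact: bigcapT_measurable.
  - by move=> n m nm; apply/subsetPset/dF.
by exists n; exact: (nP n (leqnn n)).
Qed.

End real_measure.

(** * Hyperplanes are null sets *)

Section null_hyperplane.
Context {R : realType}.
Notation mR := (measurableTypeR R).

Definition tuple_hyperplane n (u : 'I_n -> R) (c : R) : set (n.-tuple mR) :=
  [set t | \sum_(i < n) u i * (tnth t i : R) = c].

(** Induction by Fubini: if a later coefficient is nonzero, all sections are null hyperplanes;
    otherwise the set is a point times the whole space. *)
Lemma lebesgue_tuple_hyperplane n (u : 'I_n -> R) c :
  (exists i, u i != 0) -> lebesgue_tuple n (tuple_hyperplane u c) = 0%E.
Proof.
elim: n u c => [|n IH] u c [i0 ui0]; first by case: i0 ui0.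
have consE (x : mR) (t : n.-tuple mR) : tuple_hyperplane u c (tuple_cons (x, t)) =
    (u ord0 * x + \sum_(i < n) u (lift ord0 i) * (tnth t i : R) = c).
  rewrite /tuple_hyperplane /= big_ord_recl; congr (_ * _ + _ = c).
  by apply: eq_bigr => i _; rewrite tnthS.
have [[i ui]|u0] := pselect (exists i, u (lift ord0 i) != 0).
  apply: integral0_eq => x _ /=.
  rewrite (_ : xsection _ x =
      tuple_hyperplane (fun i => u (lift ord0 i)) (c - u ord0 * x)).
    by apply: IH; exists i.
  apply/seteqP; split=> t; rewrite /xsection /= inE.
    by move=> h; apply: (addrI (u ord0 * x)); rewrite [RHS]addrC subrK -consE.
  move=> h; change (tuple_hyperplane u c (tuple_cons (x, t))).
  by rewrite consE [X in _ + X]h addrC subrK.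
have u0' i : u (lift ord0 i) = 0.
  by apply/eqP; apply: contrapT => /negP h; apply: u0; exists i.
have uz : u ord0 != 0.
  by move: ui0; have [i ->|->//] := unliftP ord0 i0; rewrite u0' eqxx.
rewrite /= /cons_measure /image_measure /pushforward.
rewrite (_ : _ @^-1` _ = [set c / u ord0] `*` setT).
  rewrite [LHS](product_measure1E (@lebesgue_measure R) (lebesgue_tuple n)
    (measurable_set1 _) measurableT).
  by rewrite [X in (X * _)%E]lebesgue_measure_set1 mul0e.
apply/seteqP; split=> -[x t] /=.
  rewrite consE big1 ?addr0 => [<-|j _]; last by rewrite u0' mul0r.
  by split=> //; rewrite mulrAC divff// mul1r.
move=> [-> _]; rewrite consE big1 ?addr0 => [|j _]; last by rewrite u0' mul0r.
by rewrite mulrC divfK.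
Qed.

Lemma lebesgue_rV_hyperplane d (u : 'rV[R]_d) c :
  u != 0 -> lebesgue_rV [set x : borel_rV R d | dotv u x = c] = 0%E.
Proof.
move=> u0; rewrite -(@lebesgue_tuple_hyperplane d (fun i => u 0 i) c).
  rewrite -[LHS]/(lebesgue_tuple d
    ((fun t => rV_of_tuple t) @^-1` [set x | dotv u x = c])).
  congr (lebesgue_tuple d _); apply/funext => t.
  rewrite /preimage /mkset /tuple_hyperplane /dotv /=.
  by congr (_ = c); apply: eq_bigr => i _; rewrite mxE.
apply: contrapT => /forallNP h; move/eqP: u0; apply; apply/rowP => i.
by rewrite mxE; apply/eqP; have := h i; move/negP; rewrite negbK.
Qed.

Lemma dotv_continuous d (u : 'rV[R]_d) : continuous (dotv u).
Proof.
move=> x; apply: (@cvg_sum_fin _ _ _ _ _ (nbhs x) _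
  (fun i (z : 'rV[R]_d) => u 0 i * z 0 i)) => i _.
by apply: cvgM; [exact: cvg_cst|exact: coord_continuous].
Qed.

Lemma open_borel_measurable d (U : set 'rV[R]_d) :
  open U -> measurable (U : set (borel_rV R d)).
Proof. exact: sub_sigma_algebra. Qed.

Lemma closed_borel_measurable d (C : set 'rV[R]_d) :
  closed C -> measurable (C : set (borel_rV R d)).
Proof.
by move=> cC; rewrite -(setCK C); apply: measurableC; apply: open_borel_measurable;
  rewrite openC.
Qed.

Lemma closed_dotv_le d (u : 'rV[R]_d) c : closed [set x | dotv u x <= c].
Proof.
apply: (@closed_comp _ _ (dotv u) [set y | y <= c]); last exact: closed_le.
by move=> x _; exact: dotv_continuous.
Qed.

Lemma closed_dotv_ge d (u : 'rV[R]_d) c : closed [set x | c <= dotv u x].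
Proof.
apply: (@closed_comp _ _ (dotv u) [set y | c <= y]); last exact: closed_ge.
by move=> x _; exact: dotv_continuous.
Qed.

Lemma measurable_dotv_eq d (u : 'rV[R]_d) c :
  measurable ([set x | dotv u x = c] : set (borel_rV R d)).
Proof.
apply: closed_borel_measurable.
apply: (@closed_comp _ _ (dotv u) [set c]); last exact: closed_eq.
by move=> x _; exact: dotv_continuous.
Qed.

Lemma mass_hyperplane d (mu : {measure set (borel_rV R d) -> \bar R})
    (u : 'rV[R]_d) c : mass_distribution mu -> u != 0 ->
  mu [set x | dotv u x = c] = 0%E.
Proof.
move=> [_ [f fint fE] _] u0; rewrite fE; last exact: measurable_dotv_eq.
apply: null_set_integral.
- exact: measurable_dotv_eq.
- apply: (@measurable_funS _ _ _ _ setT) => //.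
  exact: measurable_int fint.
- exact: lebesgue_rV_hyperplane.
Qed.

End null_hyperplane.

(** * Perturbation of half-spaces *)

Section halfspaces.
Context {R : realType} {d : nat}.
Implicit Types (u : 'rV[R]_d) (c : R) (b : bool).

Definition hs u c b : set 'rV[R]_d :=
  if b then [set x | c <= dotv u x] else [set x | dotv u x <= c].

Lemma measurable_hs u c b : measurable (hs u c b : set (borel_rV R d)).
Proof.
apply: closed_borel_measurable.
by case: b; [exact: closed_dotv_ge|exact: closed_dotv_le].
Qed.

Lemma dotvN u x : dotv (- u) x = - dotv u x.
Proof. by rewrite /dotv -sumrN; apply: eq_bigr => i _; rewrite mxE mulNr. Qed.

Lemma hsN u c b : hs (- u) (- c) b = hs u c (~~ b).
Proof.
by case: b; apply/funext => x; rewrite /hs /mkset /= dotvN lerN2.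
Qed.

Definition absum (x : 'rV[R]_d) : R := \sum_i `|x 0 i|.

Lemma absum_ge0 x : 0 <= absum x.
Proof. by apply: sumr_ge0 => i _; exact: normr_ge0. Qed.

(** Contains the points whose side can change when the normal and the offset move by at most [e].
    The factor [1 + absum x] accounts for tilting, which displaces far points more. *)
Definition slab u c (e : R) : set 'rV[R]_d :=
  [set x | `|dotv u x - c| <= e * (1 + absum x)].

Lemma measurable_slab u c e : measurable (slab u c e : set (borel_rV R d)).
Proof.
apply: closed_borel_measurable.
rewrite (_ : slab u c e =
    (fun x => `|dotv u x - c| - e * (1 + absum x)) @^-1` [set y | y <= 0]).
  apply: closed_comp; last exact: closed_le.
  move=> x _.
  have h1 : `|dotv u z - c| @[z --> x] --> `|dotv u x - c|.
    apply: (@cvg_norm _ _ _ (nbhs x) _ (fun z => dotv u z - c)).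
    apply: (@cvgB _ _ _ (nbhs x) _ (dotv u) (cst c)); last exact: cvg_cst.
    exact: dotv_continuous.
  have h2 : absum z @[z --> x] --> absum x.
    apply: (@cvg_sum_fin _ _ _ _ _ (nbhs x) _
      (fun i (z : 'rV[R]_d) => `|z 0 i|)) => i _.
    apply: (@cvg_norm _ _ _ (nbhs x) _ (fun z : 'rV[R]_d => z 0 i)).
    exact: coord_continuous.
  have h3 : 1 + absum z @[z --> x] --> 1 + absum x.
    by apply: cvgD h2; exact: cvg_cst.
  by apply: cvgB h1 _; apply: cvgM h3; exact: cvg_cst.
by apply/funext => x; rewrite /slab /preimage /mkset /= subr_le0.
Qed.

Lemma slab_mono u c e e' : e <= e' -> slab u c e `<=` slab u c e'.
Proof.
move=> ee x /le_trans; apply; rewrite ler_wpM2r//.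
by rewrite addr_ge0// absum_ge0.
Qed.

Lemma dotv_near u u' c c' e x :
  (forall i, `|u' 0 i - u 0 i| <= e) -> `|c' - c| <= e ->
  `|(dotv u' x - c') - (dotv u x - c)| <= e * (1 + absum x).
Proof.
move=> ue ce; rewrite mulrDr mulr1 [e + _]addrC.
have -> : dotv u' x - c' - (dotv u x - c) = dotv u' x - dotv u x - (c' - c).
  by ring.
rewrite (le_trans (ler_normB _ _))// lerD//.
rewrite /dotv -sumrB mulr_sumr (le_trans (ler_norm_sum _ _ _))// ler_sum// => i _.
by rewrite -mulrBl normrM ler_wpM2r.
Qed.

Lemma hs_near u u' c c' b e x :
  (forall i, `|u' 0 i - u 0 i| <= e) -> `|c' - c| <= e ->
  ~ slab u c e x -> hs u c b x <-> hs u' c' b x.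
Proof.
move=> ue ce /negP; rewrite /slab /= -ltNge => sx.
have h := dotv_near x ue ce.
have {h sx} := le_lt_trans h sx.
set y := dotv u x - c; set z := dotv u' x - c'.
have -> : hs u c b x <-> if b then 0 <= y else y <= 0.
  by rewrite /hs /y; case: b; rewrite /= ?subr_ge0 ?subr_le0.
have -> : hs u' c' b x <-> if b then 0 <= z else z <= 0.
  by rewrite /hs /z; case: b; rewrite /= ?subr_ge0 ?subr_le0.
rewrite ltr_norml; case: (ger0P y) => y0 /andP[h1 h2].
  by case: b; split; lra.
by case: b; split; lra.
Qed.

Definition cell (I : finType) (u : I -> 'rV[R]_d) (c : I -> R) (b : I -> bool) :
    set 'rV[R]_d := [set x | forall i, hs (u i) (c i) (b i) x].

Lemma measurable_cell (I : finType) (u : I -> 'rV[R]_d) (c : I -> R)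
    (b : I -> bool) :
  measurable (cell u c b : set (borel_rV R d)).
Proof.
rewrite (_ : cell u c b = \bigcap_(i in [set: I]) hs (u i) (c i) (b i)).
  apply: fin_bigcap_measurable; first exact: finite_finset.
  by move=> i _; exact: measurable_hs.
by apply/seteqP; split=> x h i; [move=> _; exact: h|exact: (h i)].
Qed.

(* For fixed u and c the half-open cells partition the space, while the closed
   ones overlap. *)
Definition hcell (I : finType) (u : I -> 'rV[R]_d) (c : I -> R) (b : I -> bool) :
    set 'rV[R]_d := [set x | forall i, b i = (c i <= dotv (u i) x)].

Lemma measurable_hcell (I : finType) (u : I -> 'rV[R]_d) (c : I -> R)
    (b : I -> bool) :
  measurable (hcell u c b : set (borel_rV R d)).
Proof.
rewrite (_ : hcell u c b = \bigcap_(i in [set: I])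
    (if b i then hs (u i) (c i) true else ~` hs (u i) (c i) true)).
  apply: fin_bigcap_measurable; first exact: finite_finset.
  move=> i _; case: ifP => _; first exact: measurable_hs.
  by apply: measurableC; exact: measurable_hs.
apply/seteqP; split=> x h i.
  by move=> _; have := h i; rewrite /hs /=; case: (b i) => /= <-.
have := h i Logic.I; case: (b i); rewrite /hs /=; first by move->.
by move=> /negP/negbTE->.
Qed.

End halfspaces.

(** * Continuity of cell masses and quantiles *)

Section mass.
Context {R : realType} {d : nat}.
Variable mu : {measure set (borel_rV R d) -> \bar R}.
Hypothesis mu_mass : mass_distribution mu.
Implicit Types (u : 'rV[R]_d) (c : R) (b : bool).

Let mu_fin : (mu setT < +oo)%E. Proof. by case: mu_mass. Qed.

Notation P := (rmeas mu).

Lemma mass_pos (U : set 'rV[R]_d) : open U -> U !=set0 -> 0 < P U.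
Proof.
move=> oU U0; have [_ _ /(_ U oU U0)] := mu_mass.
by rewrite (rmeasE mu_fin) ?lte_fin//; exact: open_borel_measurable.
Qed.

Lemma mass_hyp0 u c : u != 0 -> P [set x | dotv u x = c] = 0.
Proof. by move=> u0; rewrite /rmeas mass_hyperplane. Qed.

Lemma mass_slab u c e : u != 0 -> 0 < e -> exists2 r, 0 < r & P (slab u c r) < e.
Proof.
move=> u0 e0; pose F n := slab u c n.+1%:R^-1.
have [||||n ne] := @rmeas_decr_lt _ _ _ mu mu_fin F e.
- by move=> n; exact: measurable_slab.
- by move=> n k nk; apply: slab_mono; rewrite lef_pV2 ?posrE// ler_nat.
- rewrite (_ : \bigcap_n F n = [set x | dotv u x = c]).
    exact: mass_hyperplane.
  apply/seteqP; split=> x /=; last first.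
    move=> xc n _; rewrite /F /slab /= xc subrr normr0 mulr_ge0//.
    by rewrite addr_ge0// absum_ge0.
  move=> h; apply: contrapT => /eqP; rewrite -subr_eq0 -normr_gt0 => xc.
  have a0 : 0 < 1 + absum x by rewrite ltr_pwDl// absum_ge0.
  have q0 : 0 < `|dotv u x - c| / (1 + absum x) by rewrite divr_gt0.
  have [n _ /(_ n (leqnn n))/=] := near_infty_natSinv_lt (PosNum q0).
  by rewrite ltr_pdivlMr// ltNge; have -> := h n I.
- exact: e0.
- by exists n.+1%:R^-1.
Qed.

(** Cells of nearby data agree outside slabs around the limiting hyperplanes, and these slabs can be
    chosen with small total mass. *)
Lemma mass_cell_cvg (T : Type) (F : set_system T) {FF : Filter F} (I : finType)
    (U : T -> I -> 'rV[R]_d) (C : T -> I -> R)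
    (u : I -> 'rV[R]_d) (c : I -> R) (b : I -> bool) :
  (forall i, u i != 0) -> (forall i, U t i @[t --> F] --> u i) ->
  (forall i, C t i @[t --> F] --> c i) ->
  P (cell (U t) (C t) b) @[t --> F] --> P (cell u c b).
Proof.
move=> u0 Uu Cc; apply/cvgrPdist_lt => e e0.
have I0 : 0 < (#|I|.+1)%:R :> R by rewrite ltr0n.
have [r rP] : {r : I -> R & forall i, 0 < r i /\
    P (slab (u i) (c i) (r i)) < e / #|I|.+1%:R}.
  apply: (@choice _ _ (fun i r => 0 < r /\
    P (slab (u i) (c i) r) < e / #|I|.+1%:R)) => i.
  by have [r r0 rs] := @mass_slab (u i) (c i) _ (u0 i) (divr_gt0 e0 I0); exists r.
have S_lt : P (\bigcup_i slab (u i) (c i) (r i)) < e.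
  apply: (le_lt_trans (rmeas_bigcup_le mu_fin _)).
    by move=> i; exact: measurable_slab.
  apply: (@le_lt_trans _ _ (\sum_(i in I) e / #|I|.+1%:R)).
    by apply: ler_sum => i _; exact/ltW/(rP i).2.
  rewrite sumr_const -[ltLHS]mulr_natr -mulrA gtr_pMr// mulrC ltr_pdivrMr// mul1r.
  by rewrite ltr_nat.
have mS : measurable (\bigcup_i slab (u i) (c i) (r i) : set (borel_rV R d)).
  apply: fin_bigcup_measurable => [|i _]; first exact: finite_finset.
  exact: measurable_slab.
near=> t; apply: le_lt_trans S_lt.
have near_hs i : (forall j, `|U t i 0 j - u i 0 j| <= r i) /\ `|C t i - c i| <= r i.
  move: i; near: t; apply: filter_forall => i; near=> t; split=> [j|].
    move: j; near: t; apply: filter_forall => j.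
    have /cvgrPdist_le := @cvg_rV_coord R d T F FF _ _ j (Uu i).
    move=> /(_ _ (rP i).1); apply: filterS => t.
    by rewrite distrC.
  near: t; have /cvgrPdist_le := Cc i.
  move=> /(_ _ (rP i).1); apply: filterS => t.
  by rewrite distrC.
have eqv x : ~ (\bigcup_i slab (u i) (c i) (r i)) x ->
    cell u c b x <-> cell (U t) (C t) b x.
  move=> nx; have h i : hs (u i) (c i) (b i) x <-> hs (U t i) (C t i) (b i) x.
    apply: hs_near (near_hs i).1 (near_hs i).2 _ => sx; apply: nx; by exists i.
  by split=> hx i; apply/h.
have m1 := measurable_cell u c b; have m2 := measurable_cell (U t) (C t) b.
have bound (A B : set (borel_rV R d)) : measurable A -> measurable B ->
    (forall x, ~ (\bigcup_i slab (u i) (c i) (r i)) x -> A x -> B x) ->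
    P A - P B <= P (\bigcup_i slab (u i) (c i) (r i)).
  move=> mA mB AB; rewrite lerBlDl; apply: le_trans (rmeasU_le mu_fin mB mS).
  apply: le_rmeas => //; first exact: measurableU.
  move=> x Ax; have [sx|/AB sx] := pselect ((\bigcup_i slab (u i) (c i) (r i)) x).
    by right.
  by left; exact: sx.
rewrite ler_norml; apply/andP; split; last by apply: bound => // x /eqv ->.
by rewrite lerNl opprB; apply: bound => // x /eqv ->.
Unshelve. all: by end_near. Qed.

Lemma cell_hcell (I : finType) (u : I -> 'rV[R]_d) (c : I -> R)
    (b : I -> bool) : (forall i, u i != 0) ->
  P (cell u c b) = P (hcell u c b).
Proof.
move=> u0; pose Z := \bigcup_i [set x | dotv (u i) x = c i].
have mZ : measurable (Z : set (borel_rV R d)).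
  apply: fin_bigcup_measurable => [|i _]; first exact: finite_finset.
  exact: measurable_dotv_eq.
have PZ : P Z = 0.
  apply/eqP; rewrite eq_le rmeas_ge0 andbT.
  rewrite (le_trans (rmeas_bigcup_le mu_fin _))//.
    by move=> i; exact: measurable_dotv_eq.
  by rewrite big1// => i _; rewrite mass_hyp0.
have mc := measurable_cell u c b; have mh := measurable_hcell u c b.
apply/eqP; rewrite eq_le; apply/andP; split.
  rewrite -[leRHS]addr0 -PZ; apply: le_trans (rmeasU_le mu_fin mh mZ).
  apply: le_rmeas => //; first exact: measurableU.
  move=> x xc; have [zx|zx] := pselect (Z x); [by right|left => i].
  have := xc i; rewrite /hs; case: (b i) => /= h; first by rewrite h.
  apply/esym/negbTE; rewrite -ltNge lt_neqAle h andbT.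
  by apply/eqP => e; apply: zx; exists i.
apply: le_rmeas => // x xh i; have := xh i; rewrite /hs; case: (b i) => /= h.
  by rewrite -h.
by rewrite leNgt; apply/negP => /ltW; rewrite -h.
Qed.

Definition cdf u c : R := P (hs u c false).

Lemma cdf_cvg (T : Type) (F : set_system T) {FF : Filter F}
    (U : T -> 'rV[R]_d) (C : T -> R) u c :
  u != 0 -> U @ F --> u -> C @ F --> c -> cdf (U t) (C t) @[t --> F] --> cdf u c.
Proof.
move=> u0 Uu Cc.
have e u' c' : cdf u' c' = P (@cell R d unit (fun=> u') (fun=> c') (fun=> false)).
  by congr (P _); apply/seteqP; split=> x h; [move=> _|exact: (h tt)].
rewrite e; under eq_fun do rewrite e.
exact: mass_cell_cvg.
Qed.

(** The open slab between the two levels contains a multiple of [u], so it has positive mass. *)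
Lemma cdf_lt u c c' : u != 0 -> c < c' -> cdf u c < cdf u c'.
Proof.
move=> u0 cc.
have oU : open [set x : 'rV[R]_d | c < dotv u x < c'].
  rewrite (_ : mkset _ = dotv u @^-1` `]c, c'[%classic).
    apply: open_comp; last exact: itv_open.
    by move=> x _; exact: dotv_continuous.
  by apply/funext => x; rewrite /preimage /mkset /= in_itv.
have U0 : [set x : 'rV[R]_d | c < dotv u x < c'] !=set0.
  have uu : dotv u u != 0.
    rewrite /dotv psumr_eq0 => [|i _]; last by rewrite -expr2 sqr_ge0.
    apply: contra u0 => /allP h; apply/eqP/rowP => i; rewrite mxE.
    by have := h i (mem_index_enum _); rewrite mulf_eq0 orbb => /eqP.
  exists (((c + c') / 2 / dotv u u) *: u) => /=.
  have -> : dotv u (((c + c') / 2 / dotv u u) *: u) = (c + c') / 2.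
    rewrite -[RHS](divfK uu) {3}/dotv mulr_sumr; apply: eq_bigr => i _.
    by rewrite mxE mulrCA.
  by rewrite midf_lt//= midf_lt.
have mU := open_borel_measurable oU.
have mh1 := measurable_hs u c false; have mh2 := measurable_hs u c' false.
rewrite /cdf -subr_gt0; apply: lt_le_trans (mass_pos oU U0) _.
rewrite lerBrDr -rmeasU//; last first.
  by apply/seteqP; split=> // x [/= /andP[h _]]; rewrite /hs /= leNgt h.
apply: le_rmeas => //; first exact: measurableU.
move=> x [/= /andP[_ /ltW//]|]; rewrite /hs /= => h.
exact: le_trans h (ltW cc).
Qed.

Lemma cdf_le u c c' : u != 0 -> c <= c' -> cdf u c <= cdf u c'.
Proof. by move=> u0; rewrite le_eqVlt => /predU1P[->//|/(cdf_lt u0)/ltW]. Qed.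

Lemma mass_ge u c : u != 0 -> P (hs u c true) = P setT - cdf u c.
Proof.
move=> u0; rewrite /cdf -rmeasC//; last exact: measurable_hs.
rewrite -[RHS]addr0 -(mass_hyp0 c u0) -rmeasU//.
- congr (P _); apply/seteqP; rewrite /hs; split=> x /=.
    by rewrite le_eqVlt => /predU1P[->|h]; [right|left; apply/negP; rewrite -ltNge].
  by move=> [/negP|->//]; rewrite -ltNge => /ltW.
- by apply: measurableC; exact: measurable_hs.
- exact: measurable_dotv_eq.
- by apply/seteqP; split=> // x [/= h1 h2]; apply: h1; rewrite /hs /= h2.
Qed.

Lemma cdf_small u e : 0 < e -> exists c, cdf u c < e.
Proof.
move=> e0; pose F n := hs u (- n%:R) false.
have [|||n ne] := @rmeas_decr_lt _ _ _ mu mu_fin F e _ _ _ e0.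
- by move=> n; exact: measurable_hs.
- by move=> n k nk x; rewrite /F /hs /= => /le_trans; apply; rewrite lerN2 ler_nat.
- rewrite (_ : \bigcap_n F n = set0) ?measure0//.
  apply/seteqP; split=> // x /= h.
  have := h (Num.trunc `|dotv u x|).+1 I; rewrite /F /hs /=.
  have := truncnS_gt `|dotv u x|; have := ler_norm (- dotv u x).
  by rewrite normrN; lra.
- by exists (- n%:R).
Qed.

Lemma cdfN u c : u != 0 -> cdf (- u) (- c) = P setT - cdf u c.
Proof. by move=> u0; rewrite -mass_ge// /cdf hsN. Qed.

Lemma cdf_large u e : u != 0 -> 0 < e -> exists c, P setT - e < cdf u c.
Proof.
move=> u0 e0; have [c ce] := cdf_small (- u) e0; exists (- c).
by rewrite -[u]opprK cdfN ?oppr_eq0// ltrD2l ltrN2.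
Qed.

Lemma massT_gt0 : 0 < P setT.
Proof. by apply: mass_pos; [exact: openT|exists 0]. Qed.

(** For [u != 0] and [0 < p < 1] such a level exists by the intermediate value theorem, and it is
    unique since [cdf u] is strictly increasing; 0 is the default if there is none. *)
Definition quantile (p : R) u : R := xget 0 [set c | cdf u c = p * P setT].

Lemma cdf_quantile p u : u != 0 -> 0 < p < 1 ->
  cdf u (quantile p u) = p * P setT.
Proof.
move=> u0 /andP[p0 p1].
apply: (@xgetPex _ 0 [set c | cdf u c = p * P setT]).
have M0 := massT_gt0.
have [a ha] := cdf_small u (mulr_gt0 p0 M0).
have [|b hb] := @cdf_large u ((1 - p) * P setT) u0.
  by rewrite mulr_gt0// subr_gt0.
have {}hb : p * P setT < cdf u b.
  by move: hb; rewrite mulrBl mul1r opprB addrC subrK.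
have ab : a <= b.
  by rewrite leNgt; apply/negP => /(cdf_lt u0); lra.
have [||c _ cP] := @IVT R (cdf u) a b (p * P setT) ab.
- apply: continuous_subspaceT => c.
  by apply: cdf_cvg => //; exact: cvg_cst.
- by rewrite ge_min le_max (ltW ha) (ltW hb) orbT.
- by exists c.
Qed.

Lemma quantile_eq p u c : u != 0 -> 0 < p < 1 -> cdf u c = p * P setT ->
  quantile p u = c.
Proof.
move=> u0 p01 cP; have := cdf_quantile u0 p01; rewrite -cP.
case: (ltgtP (quantile p u) c) => // /(cdf_lt u0) h e.
  by rewrite e ltxx in h.
by rewrite e ltxx in h.
Qed.

Lemma quantileN p u : u != 0 -> 0 < p < 1 ->
  quantile (1 - p) (- u) = - quantile p u.
Proof.
move=> u0 p01; apply: quantile_eq; first by rewrite oppr_eq0.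
  by move: p01 => /andP[? ?]; rewrite subr_gt0 ltrBlDr ltrDl; apply/andP.
by rewrite cdfN// cdf_quantile// mulrBl mul1r.
Qed.

Lemma quantile_lt p q u : u != 0 -> 0 < p < 1 -> 0 < q < 1 -> p < q ->
  quantile p u < quantile q u.
Proof.
move=> u0 p01 q01 pq; rewrite ltNge; apply/negP => /(cdf_le u0).
by rewrite !cdf_quantile// ler_pM2r ?massT_gt0// leNgt pq.
Qed.

Lemma near_neq0 (T : Type) (F : set_system T) {FF : Filter F}
    (U : T -> 'rV[R]_d) u : u != 0 -> U @ F --> u -> \forall t \near F, U t != 0.
Proof.
move=> u0 Uu.
have [i ui] : exists i, u 0 i != 0.
  apply: contrapT => /forallNP h; move/eqP: u0; apply; apply/rowP => i.
  by rewrite mxE; apply/eqP; have := h i; move/negP; rewrite negbK.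
have /cvgr_neq0 /(_ ui) := @cvg_rV_coord R d T F FF _ _ i Uu.
by apply: filterS => t; apply: contra => /eqP ->; rewrite mxE.
Qed.

(** The values of [cdf] at [q - e] and [q + e] strictly enclose the target and still do so for
    nearby normals; monotonicity traps the quantile in between. *)
Lemma quantile_cvg (T : Type) (F : set_system T) {FF : Filter F}
    (U : T -> 'rV[R]_d) u p : u != 0 -> 0 < p < 1 -> U @ F --> u ->
  quantile p (U t) @[t --> F] --> quantile p u.
Proof.
move=> u0 p01 Uu; apply/cvgrPdist_lt => e e0.
set q := quantile p u.
have cl : cdf (U t) (q - e) @[t --> F] --> cdf u (q - e).
  by apply: cdf_cvg => //; exact: cvg_cst.
have cr : cdf (U t) (q + e) @[t --> F] --> cdf u (q + e).
  by apply: cdf_cvg => //; exact: cvg_cst.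
have hl : cdf u (q - e) < p * P setT.
  by rewrite -(cdf_quantile u0 p01) cdf_lt// ltrBlDr ltrDl.
have hr : p * P setT < cdf u (q + e).
  by rewrite -(cdf_quantile u0 p01) cdf_lt// ltrDl.
near=> t; have Ut0 : U t != 0 by near: t; exact: (near_neq0 u0 Uu).
have h1 : cdf (U t) (q - e) < p * P setT by near: t; exact: (cvgr_lt _ cl).
have h2 : p * P setT < cdf (U t) (q + e) by near: t; exact: (cvgr_gt _ cr).
rewrite distrC ltr_distl; apply/andP; split.
  rewrite ltNge; apply/negP => /(cdf_le Ut0); rewrite cdf_quantile//.
  by rewrite leNgt h1.
rewrite ltNge; apply/negP => /(cdf_le Ut0); rewrite cdf_quantile//.
by rewrite leNgt h2.
Unshelve. all: by end_near. Qed.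

End mass.

(** * The test map *)

Section arrangement.
Context {R : realType} {d : nat}.
Variable mu : {measure set (borel_rV R d) -> \bar R}.
Hypothesis mu_mass : mass_distribution mu.
Variables (k n : nat).
Notation P := (rmeas mu).
Notation M := (P setT).
Notation normals := ('I_n.+1 -> 'rV[R]_d).
Notation plane := ('I_(2 * k) + 'I_n)%type.
Implicit Types (u : normals) (j : 'I_(2 * k).+1) (s : {set 'I_n}).

Let mu_fin : (mu setT < +oo)%E. Proof. by case: mu_mass. Qed.

Definition level (a : nat) : R := a.+1%:R / (2 * k).+1%:R.

Lemma level01 (a : 'I_(2 * k)) : 0 < level a < 1.
Proof.
by rewrite /level divr_gt0 ?ltr0n//= ltr_pdivrMr ?ltr0n// mul1r ltr_nat ltnS.
Qed.

Lemma half01 : 0 < (2^-1 : R) < 1.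
Proof. by apply/andP; split; lra. Qed.

Definition cut u (a : 'I_(2 * k)) : R := quantile mu (level a) (u ord0).

Definition bisector u (i : 'I_n) : R := quantile mu 2^-1 (u (lift ord0 i)).

Definition nrm u (p : plane) : 'rV[R]_d :=
  match p with inl _ => u ord0 | inr i => u (lift ord0 i) end.

Definition ofs u (p : plane) : R :=
  match p with inl a => cut u a | inr i => bisector u i end.

Definition sgn j s (p : plane) : bool :=
  match p with inl a => (a < j)%N | inr i => i \in s end.

Definition bmass j s u : R := P (cell (nrm u) (ofs u) (sgn j s)).

Lemma nrm_neq0 u : (forall i, u i != 0) -> forall p, nrm u p != 0.
Proof. by move=> u0 [a|i] /=. Qed.

Lemma cut_lt u (a b : 'I_(2 * k)) : u ord0 != 0 -> (a < b)%N -> cut u a < cut u b.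
Proof.
move=> u0 ab; apply: quantile_lt => //; [exact: level01|exact: level01|].
by rewrite /level ltr_pM2r ?invr_gt0 ?ltr0n// ltr_nat.
Qed.

Lemma cut_le u (a b : 'I_(2 * k)) : u ord0 != 0 -> (a <= b)%N -> cut u a <= cut u b.
Proof.
move=> u0; rewrite leq_eqVlt => /predU1P[/val_inj ->//|/(cut_lt u0)].
exact: ltW.
Qed.

Lemma bmass_cvg (T : Type) (F : set_system T) {FF : Filter F} (U : T -> normals)
    u j s : (forall i, u i != 0) -> (forall i, U t i @[t --> F] --> u i) ->
  bmass j s (U t) @[t --> F] --> bmass j s u.
Proof.
move=> u0 Uu; apply: mass_cell_cvg => //; first exact: nrm_neq0.
  by case=> [a|i] /=.
by case=> [a|i] /=; apply: quantile_cvg => //; [exact: level01|exact: half01].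
Qed.

(** Reversing the common normal reverses the order of the cuts, as [level a] and [level (rev_ord a)]
    add up to 1; mirror slices are exchanged. *)
Lemma bmass_rev u j s : (forall i, u i != 0) ->
  bmass j s (negate_at ord0 u) = bmass (rev_ord j) s u.
Proof.
move=> u0; congr (P _).
have e (a : 'I_(2 * k)) :
    hs (nrm (negate_at ord0 u) (inl a)) (ofs (negate_at ord0 u) (inl a)) (a < j)%N =
    hs (nrm u (inl (rev_ord a))) (ofs u (inl (rev_ord a))) (rev_ord a < rev_ord j)%N.
  rewrite /= /cut /negate_at eqxx.
  have -> : level a = 1 - level (rev_ord a).
    rewrite /level /= -[X in X - _](@divff _ (2 * k).+1%:R) ?pnatr_eq0//.
    by rewrite -mulrBl -natrB; [congr (_%:R / _)|]; have := ltn_ord a; lia.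
  rewrite quantileN//; last exact: level01.
  rewrite hsN; congr (hs _ _ _).
  by have := ltn_ord a; have := ltn_ord j; lia.
have e' i : nrm (negate_at ord0 u) (inr i) = nrm u (inr i) by [].
apply/seteqP; split=> x xc [a|i].
- by have := xc (inl (rev_ord a)); rewrite /sgn e rev_ordK.
- exact: (xc (inr i)).
- by have := xc (inl (rev_ord a)); rewrite /sgn -e.
- exact: (xc (inr i)).
Qed.

Definition toggle (i : 'I_n) (s : {set 'I_n}) : {set 'I_n} :=
  [set l | (l \in s) (+) (l == i)]%SET.

Lemma toggleK i : involutive (toggle i).
Proof. by move=> s; apply/finset.setP => l; rewrite !inE addbK. Qed.

(** Opposite normals have the same median hyperplane with its two sides exchanged. *)
Lemma bmass_toggle u j s i : (forall i, u i != 0) ->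
  bmass j s (negate_at (lift ord0 i) u) = bmass j (toggle i s) u.
Proof.
move=> u0; congr (P _).
have e (l : 'I_n) : hs (nrm (negate_at (lift ord0 i) u) (inr l))
      (ofs (negate_at (lift ord0 i) u) (inr l)) (l \in s) =
    hs (nrm u (inr l)) (ofs u (inr l)) (l \in toggle i s).
  rewrite /= /bisector /negate_at inE (inj_eq lift_inj).
  case: eqP => [->|_]; last by rewrite addbF.
  rewrite addbT -hsN -quantileN//; last exact: half01.
  by congr (hs _ (quantile _ _ _)); lra.
apply/seteqP; split=> x xc [a|l].
- exact: (xc (inl a)).
- by have := xc (inr l); rewrite /sgn e.
- exact: (xc (inl a)).
- by have := xc (inr l); rewrite /sgn -e.
Qed.

Section marginals.
Variable u : normals.
Hypothesis u0 : forall i, u i != 0.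
Notation hc j s := (hcell (nrm u) (ofs u) (sgn j s)).

Definition slice (j : nat) : set 'rV[R]_d :=
  [set x | forall a : 'I_(2 * k), (a < j)%N = (cut u a <= dotv (u ord0) x)].

Definition below (j : nat) : set 'rV[R]_d :=
  [set x | forall a : 'I_(2 * k), (j <= a)%N -> dotv (u ord0) x < cut u a].

Lemma belowE (a : 'I_(2 * k)) : below a = ~` hs (u ord0) (cut u a) true.
Proof.
apply/seteqP; split=> x; rewrite /hs /= => xa.
  by apply/negP; rewrite -ltNge; exact: xa.
move=> b ab; apply: lt_le_trans (cut_le (u0 _) ab).
by rewrite ltNge; apply/negP.
Qed.

Lemma below_max : below (2 * k) = setT.
Proof. by apply/seteqP; split=> // x _ a; rewrite leqNgt ltn_ord. Qed.

Lemma measurable_below j : measurable (below j : set (borel_rV R d)).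
Proof.
case: (ltnP j (2 * k)) => jk; last first.
  have -> : (j : nat) = (2 * k)%N by have := ltn_ord j; lia.
  by rewrite below_max.
rewrite -[j : nat]/(Ordinal jk : nat) belowE.
by apply: measurableC; exact: measurable_hs.
Qed.

Lemma mass_below j : P (below j) = level j * M.
Proof.
case: (ltnP j (2 * k)) => jk; last first.
  have -> : (j : nat) = (2 * k)%N by have := ltn_ord j; lia.
  by rewrite below_max /level divff ?mul1r// pnatr_eq0.
rewrite -[j : nat]/(Ordinal jk : nat) belowE.
rewrite (rmeasC mu_fin); last exact: measurable_hs.
rewrite (mass_ge mu_mass)// (cdf_quantile mu_mass)//; last exact: level01.
by rewrite opprB addrC subrK.
Qed.

Lemma slice0 : slice 0 = below 0.
Proof.
apply/seteqP; split=> x h a; last by have := h a; rewrite leNgt => ->.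
by move=> _; have := h a; rewrite ltn0 leNgt; case: ltP.
Qed.

Lemma sliceS (a : 'I_(2 * k)) : slice a.+1 = below a.+1 `\` below a.
Proof.
apply/seteqP; split=> x; rewrite [in X in _ `\` X]belowE.
  move=> h; split=> [b ab|]; first by rewrite ltNge -h -leqNgt.
  by rewrite /hs /= -h ltnSn.
move=> [h1 /contrapT]; rewrite /hs /= => h2 b.
case: ltnP => [ba|ab]; last by apply/esym/negbTE; rewrite -ltNge; exact: h1.
by apply/esym; apply: le_trans h2; exact: cut_le.
Qed.

Lemma mass_slice j : P (slice j) = M / (2 * k).+1%:R.
Proof.
have e (i : nat) : level i.+1 * M - level i * M = M / (2 * k).+1%:R.
  by rewrite -mulrBl /level -mulrBl -natrB// subSnn mul1r mulrC.
move: j => [[|j] jk] /=.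
  by rewrite slice0 (mass_below ord0) /level mul1r mulrC.
have /= -> := sliceS (Ordinal (jk : (j < 2 * k)%N)).
have mb := measurable_below (Ordinal jk).
have ma := measurable_below (Ordinal (ltnW jk)).
rewrite -(e j) -(mass_below (Ordinal jk)) -(mass_below (Ordinal (ltnW jk))) /=.
rewrite [X in _ = X - _](rmeasDI mu_fin mb ma).
rewrite (_ : _ `&` _ = below j) ?addrK//.
apply/seteqP; split=> [x []//|x h]; split=> //= a ja; apply: h.
exact: ltnW.
Qed.

Lemma slice_cover x : exists j, slice j x.
Proof.
have ex : exists j : nat, (j <= 2 * k)%N && `[< below j x >].
  by exists (2 * k)%N; rewrite leqnn; apply/asboolP; rewrite below_max.
(* The slice index is that of the first cut above [x], or [2 * k] if there is none. *)
case: (ex_minnP ex) => j /andP[jk /asboolP bj] jmin.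
have jk' : (j < (2 * k).+1)%N by [].
exists (Ordinal jk') => /=; case: j => [|j] in jk bj jmin jk' *.
  by rewrite slice0.
have /= -> := sliceS (Ordinal (jk : (j < 2 * k)%N)); split=> // bj'.
have := jmin j; rewrite ltnn => h; have : false; last by [].
by apply: h; rewrite ltnW//; exact/asboolP.
Qed.

Lemma hcellE j s x : hc j s x <->
  slice j x /\ forall i, (i \in s) = (bisector u i <= dotv (u (lift ord0 i)) x).
Proof.
split=> [h|[h1 h2] [a|i]]; [|exact: h1|exact: h2].
by split=> [a|i]; [exact: (h (inl a))|exact: (h (inr i))].
Qed.

Definition side (x : 'rV[R]_d) : {set 'I_n} :=
  [set i | bisector u i <= dotv (u (lift ord0 i)) x]%SET.

Lemma hcell_side j x : slice j x -> hc j (side x) x.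
Proof. by move=> jx; apply/hcellE; split=> // i; rewrite inE. Qed.

Lemma hcell_inj j j' s s' x : hc j s x -> hc j' s' x -> j = j' /\ s = s'.
Proof.
move=> /hcellE[h1 h2] /hcellE[h3 h4]; split; last first.
  by apply/finset.setP => i; rewrite h2 h4.
have h (a : 'I_(2 * k)) : (a < j)%N = (a < j')%N by rewrite h1 h3.
apply/val_inj => /=; case: (ltngtP j j') => // jj.
- have jk : (j < 2 * k)%N by apply: leq_trans jj _; rewrite -ltnS.
  by have := h (Ordinal jk); rewrite /= ltnn jj.
- have jk : (j' < 2 * k)%N by apply: leq_trans jj _; rewrite -ltnS.
  by have := h (Ordinal jk); rewrite /= ltnn jj.
Qed.

Lemma bmassE j s : bmass j s u = P (hc j s).
Proof. by apply: cell_hcell => //; exact: nrm_neq0. Qed.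

Lemma sum_bmass j : \sum_s bmass j s u = M / (2 * k).+1%:R.
Proof.
rewrite -(mass_slice j) (eq_bigr (fun s => P (hc j s))) => [|s _]; last exact: bmassE.
rewrite -(@rmeas_bigcup _ _ _ mu mu_fin _ xpredT).
- congr (P _); apply/seteqP; split=> x; first by move=> [s _ /hcellE[]].
  by move=> jx; exists (side x) => //; exact: hcell_side.
- by move=> s; exact: measurable_hcell.
- by move=> s s' [x [h1 h2]]; have [] := hcell_inj h1 h2.
Qed.

Lemma sum_bmass_side i :
  \sum_j \sum_(s : {set 'I_n} | i \in s) bmass j s u = M / 2.
Proof.
rewrite pair_big/= (eq_bigr (fun q : 'I_(2 * k).+1 * {set 'I_n} =>
  P (hc q.1 q.2))) => [|q _]; last exact: bmassE.
rewrite -(@rmeas_bigcup _ _ _ mu mu_fin).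
- rewrite -[RHS](_ : P (hs (u (lift ord0 i)) (bisector u i) true) = _); last first.
    rewrite (mass_ge mu_mass)// (cdf_quantile mu_mass)//; last exact: half01.
    by lra.
  congr (P _); apply/seteqP; split=> x.
    by move=> [[j s] /= si /hcellE[_ h]]; rewrite /hs /= -h.
  rewrite /hs /= => xi; have [j jx] := slice_cover x.
  exists (j, side x); last exact: hcell_side.
  by rewrite /= unfold_in /= inE.
- by move=> q; exact: measurable_hcell.
- by move=> [j s] [j' s'] [x [/= h1 h2]]; have [-> ->] := hcell_inj h1 h2.
Qed.

End marginals.

(** * Walsh coefficients of the slices *)

Definition walsh (a s : {set 'I_n}) : R := \prod_(i in a) (-1) ^+ (i \in s).

Definition coef j (a : {set 'I_n}) u : R := \sum_s walsh a s * bmass j s u.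

Lemma coef_rev j a u : (forall i, u i != 0) ->
  coef j a (negate_at ord0 u) = coef (rev_ord j) a u.
Proof. by move=> u0; apply: eq_bigr => s _; rewrite bmass_rev. Qed.

Lemma walsh_toggle a s i : walsh a (toggle i s) = (-1) ^+ (i \in a) * walsh a s.
Proof.
rewrite /walsh (eq_bigr (fun l => (-1) ^+ (l \in s) * (-1) ^+ (l == i))).
  rewrite big_split/= mulrC; congr (_ * _).
  case: (boolP (i \in a)) => ia.
    rewrite (bigD1 i)//= eqxx big1 ?mulr1// => l /andP[_ /negbTE ->].
    by rewrite expr0.
  by rewrite big1// => l la; case: eqP la ia => // -> ->.
by move=> l _; rewrite inE signr_addb.
Qed.

Lemma coef_toggle j a u i : (forall i, u i != 0) ->
  coef j a (negate_at (lift ord0 i) u) = (-1) ^+ (i \in a) * coef j a u.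
Proof.
move=> u0; rewrite /coef [LHS](reindex_inj (inv_inj (toggleK i)))/= mulr_sumr.
apply: eq_bigr => s _.
by rewrite bmass_toggle// toggleK walsh_toggle mulrA.
Qed.

Lemma coef_cvg (T : Type) (F : set_system T) {FF : Filter F} (U : T -> normals)
    u j a : (forall i, u i != 0) -> (forall i, U t i @[t --> F] --> u i) ->
  coef j a (U t) @[t --> F] --> coef j a u.
Proof.
move=> u0 Uu; apply: cvg_sum_fin => s _.
by apply: cvgM; [exact: cvg_cst|exact: bmass_cvg].
Qed.

(** Orthogonality of characters: the sum over [a] factors over coordinates, and one where [s] and
    [s'] differ gives -1 + 1. *)
Lemma sum_walsh s s' :
  \sum_a walsh a s * walsh a s' = if s == s' then (2 ^ n)%:R else 0.
Proof.
transitivity (\prod_(i < n) ((-1) ^+ ((i \in s) (+) (i \in s')) + 1) : R).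
  rewrite bigA_distr; apply: eq_bigr => a _.
  rewrite /walsh -big_split/= big_mkcond/=; apply: eq_bigr => i _.
  by case: (i \in a) => //; rewrite signr_addb.
case: eqP => [->|ss].
  rewrite (eq_bigr (fun=> 2%:R)) => [|i _]; last by rewrite addbb.
  by rewrite prodr_const card_ord natrX.
have [i si] : exists i, (i \in s) (+) (i \in s').
  apply: contrapT => /forallNP h; apply: ss; apply/finset.setP => i.
  by have := h i; case: (i \in s); case: (i \in s').
by rewrite (bigD1 i)//= si expr1 addNr mul0r.
Qed.

Lemma walsh0 s : walsh finset.set0 s = 1.
Proof. by rewrite /walsh big_set0. Qed.

(** Walsh inversion: with only the trivial coefficient left, each box has the average mass of its
    slice, and the slices are equal. *)
Lemma bmass_eq j s u : (forall i, u i != 0) ->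
  (forall a, a != finset.set0 -> coef j a u = 0) ->
  bmass j s u = M / ((2 * k).+1 * 2 ^ n)%:R.
Proof.
move=> u0 h.
have e : (2 ^ n)%:R * bmass j s u = M / (2 * k).+1%:R.
  rewrite -(sum_bmass u0 j).
  transitivity (\sum_a walsh a s * coef j a u).
    rewrite /coef; under eq_bigr do rewrite mulr_sumr.
    rewrite exchange_big/= (bigD1 s)//= [X in _ = _ + X]big1 ?addr0.
      under eq_bigr do rewrite mulrA.
      by rewrite -mulr_suml sum_walsh eqxx.
    move=> s' s's; under eq_bigr do rewrite mulrA.
    by rewrite -mulr_suml sum_walsh eq_sym (negbTE s's) mul0r.
  rewrite (bigD1 finset.set0)//= big1 ?addr0 => [|a a0]; last by rewrite h// mulr0.
  rewrite walsh0 mul1r; apply: eq_bigr => s' _.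
  by rewrite walsh0 mul1r.
have p0 : (2 ^ n)%:R != 0 :> R by rewrite pnatr_eq0 expn_eq0.
by apply: (mulfI p0); rewrite e natrM invfM [RHS]mulrCA
  [X in _ = _ * X]mulrCA divff// mulr1.
Qed.

(** The singleton coefficient of a slice is its mass minus twice the part on one side of hyperplane
    [i]. The total is 0 because that hyperplane bisects the whole mass. *)
Lemma sum_coef_set1 u i : (forall i, u i != 0) ->
  \sum_j coef j [set i]%SET u = 0.
Proof.
move=> u0.
have e j : coef j [set i]%SET u =
    \sum_s bmass j s u - 2 * \sum_(s : {set 'I_n} | i \in s) bmass j s u.
  rewrite /coef [X in _ = _ - 2 * X]big_mkcond/= mulr_sumr -sumrB.
  apply: eq_bigr => s _; rewrite /walsh finset.big_set1.
  by case: (i \in s); rewrite ?expr1 ?expr0; ring.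
rewrite (eq_bigr _ (fun j _ => e j)) sumrB -mulr_sumr (sum_bmass_side u0).
rewrite (eq_bigr (fun=> M / (2 * k).+1%:R)) => [|j _]; last exact: sum_bmass.
rewrite sumr_const card_ord -[_ *+ _]mulr_natr divfK ?pnatr_eq0//.
by rewrite mulrCA divff ?mulr1 ?subrr// pnatr_eq0.
Qed.

End arrangement.

(** * Test functions and their sign characters *)

Section tests.
Context {R : realType} {d : nat}.
Variable mu : {measure set (borel_rV R d) -> \bar R}.
Hypothesis mu_mass : mass_distribution mu.
Variables (k n : nat).
Notation coef := (@coef R d mu k n).
Notation normals := ('I_n.+1 -> 'rV[R]_d).

Definition test_index := ({set 'I_n} + 'I_k * bool * {set 'I_n})%type.

Definition mid : 'I_(2 * k).+1 := inord k.

Definition low (j : 'I_k) : 'I_(2 * k).+1 := inord j.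

Lemma rev_mid : rev_ord mid = mid.
Proof. by apply/val_inj; rewrite /= /mid /= inordK; lia. Qed.

(* For a slice j and its mirror image, the Walsh coefficients a of the two
   slices are combined into an even and an odd test function. *)
Definition test (c : test_index) (u : normals) : R :=
  match c with
  | inl a => coef mid a u
  | inr (j, b, a) => coef (low j) a u + (-1) ^+ b * coef (rev_ord (low j)) a u
  end.

Definition test_char (c : test_index) : {set 'I_n.+1} :=
  match c with
  | inl a => (lift ord0 @: a)%SET
  | inr (j, b, a) =>
    if b then (ord0 |: lift ord0 @: a)%SET else (lift ord0 @: a)%SET
  end.

(* For a singleton a, the coefficient of the middle slice need not be tested:
   the coefficients of all slices sum to 0. *)
Definition tested (c : test_index) : bool :=
  match c with
  | inl a => (1 < #|a|)%N
  | inr (_, _, a) => a != finset.set0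
  end.

(** Negating [u ord0] exchanges mirror slices, which fixes the sum of their coefficients and negates
    the difference; the middle slice is its own mirror. Other normals act through the Walsh
    character. *)
Lemma test_negate c i (u : normals) : (forall l, u l != 0) ->
  test c (negate_at i u) = (-1) ^+ (i \in test_char c) * test c u.
Proof.
move=> u0.
have o0 (a : {set 'I_n}) : (ord0 \in (lift ord0 @: a)%SET) = false.
  by apply/negbTE/imsetP => -[l _ /eqP]; rewrite (negbTE (neq_lift _ _)).
have ol l (a : {set 'I_n}) : (lift ord0 l \in (lift ord0 @: a)%SET) = (l \in a).
  by rewrite mem_imset//; exact: lift_inj.
have [l ->|->] := unliftP ord0 i.
  case: c => [a|[[j b] a]] /=; first by rewrite coef_toggle// ol.
  rewrite !coef_toggle//.
  have -> : (lift ord0 l \in if b then (ord0 |: lift ord0 @: a)%SET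
      else (lift ord0 @: a)%SET) = (l \in a).
    by case: b; rewrite ?inE ol// eq_sym (negbTE (neq_lift _ _)).
  by ring.
case: c => [a|[[j b] a]] /=.
  by rewrite coef_rev// rev_mid o0 mul1r.
rewrite !coef_rev// rev_ordK; case: b; rewrite ?finset.setU11 ?o0 ?expr1 ?expr0.
  by ring.
by ring.
Qed.

Lemma test_cvg (T : Type) (F : set_system T) {FF : Filter F} (U : T -> normals)
    (u : normals) c : (forall i, u i != 0) -> (forall i, U t i @[t --> F] --> u i) ->
  test c (U t) @[t --> F] --> test c u.
Proof.
move=> u0 Uu; case: c => [a|[[j b] a]] /=; first exact: coef_cvg.
apply: cvgD; first exact: coef_cvg.
by apply: cvgM; [exact: cvg_cst|exact: coef_cvg].
Qed.

(** Sum and difference of mirror coefficients determine both; in the middle slice only the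
    singletons remain, and [sum_coef_set1] settles them. *)
Lemma test_zero (u : normals) : (forall i, u i != 0) ->
  (forall c, tested c -> test c u = 0) ->
  forall j a, a != finset.set0 -> coef j a u = 0.
Proof.
move=> u0 tu.
have lowE (j : 'I_k) a : a != finset.set0 ->
    coef (low j) a u = 0 /\ coef (rev_ord (low j)) a u = 0.
  move=> a0; have := tu (inr (j, false, a)) a0; have := tu (inr (j, true, a)) a0.
  by rewrite /= expr0 expr1; lra.
have off_mid (j : 'I_(2 * k).+1) a : a != finset.set0 -> j != k :> nat ->
    coef j a u = 0.
  move=> a0; case: ltngtP => // jk _.
    rewrite (_ : j = low (Ordinal jk)); first by have [] := lowE (Ordinal jk) a a0.
    by apply/val_inj; rewrite /= /low /= inordK//; lia.
  have jk' : (2 * k - j < k)%N by have := ltn_ord j; lia.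
  rewrite (_ : j = rev_ord (low (Ordinal jk'))).
    by have [] := lowE (Ordinal jk') a a0.
  by apply/val_inj; rewrite /= /low /= inordK//=; have := ltn_ord j; lia.
move=> j a a0; have [jk|] := eqVneq (j : nat) k; last exact: off_mid.
have -> : j = mid by apply/val_inj; rewrite /= jk /mid inordK//; lia.
have [a1|a1] := ltnP 1 #|a|; first exact: (tu (inl a)).
have /cards1P[i ->] : #|a| == 1%N.
  by move: a0 a1; rewrite -card_gt0; case: #|a| => [|[]].
have := sum_coef_set1 mu_mass k i u0.
rewrite (bigD1 mid)//= big1 ?addr0// => l lm; apply: off_mid.
  by apply/finset.set0Pn; exists i; rewrite inE.
apply: contra lm => /eqP lk; apply/eqP/val_inj.
by rewrite /= /mid /= inordK//; lia.
Qed.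

(** Omitting the singletons of the middle slice matches the division by all variables, and each of
    the [k] mirror pairs gives a Dickson polynomial divided by its first variable. *)
Lemma prod_tested (A : comNzRingType) (x : 'I_n.+1 -> A) :
  \prod_(c | tested c) lin_form x (test_char c) =
  (\prod_(s : {set 'I_n} | (1 < #|s|)%N) lin_form (x \o lift ord0) s) *
  (\prod_(s : {set 'I_n} | s != finset.set0) (lin_form (x \o lift ord0) s *
    (x ord0 + lin_form (x \o lift ord0) s))) ^+ k.
Proof.
rewrite big_sumType/=; congr (_ * _).
  by apply: eq_bigr => s _; rewrite lin_form_lift.
transitivity (\prod_(j : 'I_k) \prod_(b : bool)
   \prod_(s : {set 'I_n} | s != finset.set0) lin_form x (test_char (inr (j, b, s)))).
  rewrite pair_bigA/= pair_big_dep/=.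
  by apply: eq_big => -[[j b] s].
rewrite -[X in _ ^+ X](card_ord k) -prodr_const; apply: eq_bigr => j _.
rewrite big_bool/= mulrC -big_split/=; apply: eq_bigr => s _.
by rewrite lin_form_lift lin_form_liftU.
Qed.

End tests.

(** * Non-parallelism and conclusion *)

Section parallel.
Context {R : realType} {d : nat}.
Variable mu : {measure set (borel_rV R d) -> \bar R}.
Hypothesis mu_mass : mass_distribution mu.

Lemma dotvZ t (u x : 'rV[R]_d) : dotv (t *: u) x = t * dotv u x.
Proof. by rewrite /dotv mulr_sumr; apply: eq_bigr => i _; rewrite mxE mulrA. Qed.

Lemma hsZ t (u : 'rV[R]_d) c b : 0 < t -> hs (t *: u) (t * c) b = hs u c b.
Proof.
by move=> t0; case: b; apply/funext => x; rewrite /hs /mkset /= dotvZ ler_pM2l.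
Qed.

(** The median hyperplane depends only on the line spanned by its normal; a negative factor
    exchanges the sides. *)
Lemma half_hsZ t (u : 'rV[R]_d) b : u != 0 -> t != 0 ->
  hs (t *: u) (quantile mu 2^-1 (t *: u)) b =
  hs u (quantile mu 2^-1 u) (b (+) (t < 0)).
Proof.
have pos r v b' : v != 0 -> 0 < r ->
    hs (r *: v) (quantile mu 2^-1 (r *: v)) b' = hs v (quantile mu 2^-1 v) b'.
  move=> v0 r0; rewrite -(hsZ v _ b' r0); congr (hs _ _ _).
  apply: (quantile_eq mu_mass); last first.
  - by rewrite /cdf hsZ// -(cdf_quantile mu_mass v0 half01).
  - exact: half01.
  - by rewrite scaler_eq0 negb_or v0 gt_eqF.
move=> u0 t0; case: ltP => tn; last by rewrite addbF pos// lt_neqAle eq_sym t0.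
rewrite addbT -(pos (- t) u) ?oppr_gt0// scaleNr.
rewrite -hsN -quantileN//; last 2 first.
- by rewrite oppr_eq0 scaler_eq0 negb_or u0 t0.
- exact: half01.
by rewrite opprK; congr (hs _ (quantile _ _ _) _); lra.
Qed.

End parallel.

Section main.
Context {R : realType} {d : nat}.
Variable mu : {measure set (borel_rV R d) -> \bar R}.
Hypothesis mu_mass : mass_distribution mu.
Variables (k n : nat) (u : 'I_n.+1 -> 'rV[R]_d).
Hypothesis u0 : forall i, u i != 0.
Hypothesis bm : forall (j : 'I_(2 * k).+1) (s : {set 'I_n}), bmass mu j s u =
  rmeas mu setT / ((2 * k).+1 * 2 ^ n)%:R.

Lemma bmass_gt0 (j : 'I_(2 * k).+1) (s : {set 'I_n}) : 0 < bmass mu j s u.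
Proof.
by rewrite bm divr_gt0 ?(massT_gt0 mu_mass)// ltr0n muln_gt0 expn_gt0.
Qed.

Definition cuts (a : 'I_(2 * k)) : hyperplane R d :=
  Hyperplane (cut mu u a) (u0 ord0).

Definition bisectors (i : 'I_n) : hyperplane R d :=
  Hyperplane (bisector mu u i) (u0 (lift ord0 i)).

Lemma cuts_collection : parallel_collection cuts.
Proof. by split=> // a b ab; apply: (cut_lt mu_mass). Qed.

(** Otherwise the median hyperplane lies strictly beyond the first cut, as 1/(2k+1) < 1/2, and a box
    of the first slice on its far side would be empty. *)
Lemma bisector_cut_not_parallel i a : ~ parallel (bisectors i) (cuts a).
Proof.
move=> [t /= ut].
have t0 : t != 0.
  by apply: contraNneq (u0 (lift ord0 i)) => tz; rewrite ut tz scale0r.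
(* The set [s] selects the side above the median in direction [u ord0], whatever the sign of [t]. *)
pose s : {set 'I_n} := if t < 0 then finset.set0 else [set i]%SET.
have := bmass_gt0 (@ord0 (2 * k)) s.
rewrite /bmass (_ : cell _ _ _ = set0) ?rmeas0 ?ltxx//.
apply/seteqP; split=> // x xc /=.
have k0 : (0 < 2 * k)%N by apply: leq_ltn_trans (ltn_ord a).
have := xc (inl (Ordinal k0)); rewrite /hs /= => h1.
have := xc (inr i); rewrite /= /bisector ut (half_hsZ mu_mass)//.
have -> : (i \in s) (+) (t < 0).
  by rewrite /s; case: (t < 0); rewrite !inE ?eqxx.
rewrite /hs /= => h2; have := le_trans h2 h1; rewrite leNgt => /negP; apply.
apply: (quantile_lt mu_mass) => //; [exact: (level01 (Ordinal k0))|exact: half01|].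
rewrite /level mul1r ltf_pV2 ?posrE ?ltr0n// ltr_nat.
by have := k0; lia.
Qed.

(** Parallel bisectors coincide since the median is unique, and a box on opposite sides of the two
    would lie in a null hyperplane. *)
Lemma bisectors_not_parallel i j : i != j -> ~ parallel (bisectors i) (bisectors j).
Proof.
move=> ij [t /= ut].
have t0 : t != 0.
  by apply: contraNneq (u0 (lift ord0 i)) => tz; rewrite ut tz scale0r.
pose s : {set 'I_n} := if t < 0 then finset.set0 else [set j]%SET.
have := bmass_gt0 (@ord0 (2 * k)) s.
suff h : rmeas mu (cell (nrm u) (ofs mu u) (sgn (@ord0 (2 * k)) s)) <= 0.
  by rewrite /bmass ltNge h.
rewrite -(mass_hyp0 mu_mass (bisector mu u j) (u0 (lift ord0 j))).
apply: le_rmeas; first by case: mu_mass.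
- exact: measurable_cell.
- exact: measurable_dotv_eq.
move=> x xc /=; have := xc (inr i); have := xc (inr j).
rewrite /= /bisector ut (half_hsZ mu_mass)//.
rewrite /s; case: (t < 0); rewrite !inE ?eqxx ?(negbTE ij) /hs /= => h1 h2.
  by apply/eqP; rewrite eq_le h1 h2.
by apply/eqP; rewrite eq_le h1 h2.
Qed.

Lemma equipartition_bmass : equipartition mu cuts bisectors.
Proof.
move=> j s; pose s' : {set 'I_n} := [set i | s i]%SET.
have boxE : box cuts bisectors j s = cell (nrm u) (ofs mu u) (sgn j s').
  apply/seteqP; split=> x.
    by move=> [h1 h2] [a|i] /=; [exact: (h1 a)|rewrite inE; exact: (h2 i)].
  move=> h; split=> [a|i]; first exact: (h (inl a)).
  by have := h (inr i); rewrite /= inE.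
have mfin : (mu setT < +oo)%E by case: mu_mass.
rewrite boxE (rmeasE mfin); last exact: measurable_cell.
rewrite -[rmeas _ _]/(bmass mu j s' u) bm (rmeasE mfin measurableT).
by rewrite -EFinM mulrC.
Qed.

End main.

Lemma F2_mpoly_char2 n : 2%:R = 0 :> mpoly.mpoly n 'F_2.
Proof.
rewrite -[LHS]/(1 *+ 2) -scaler_nat (_ : 2%:R = 0) ?scale0r//.
exact: val_inj.
Qed.

Lemma var_neq0 n (i : 'I_n) : var i != 0.
Proof.
apply/eqP => /(congr1 (mpoly.mcoeff (mpoly.mnm1 i))).
by rewrite mpoly.mcoeffX mpoly.mcoeff0 eqxx => /eqP; rewrite oner_eq0.
Qed.

Lemma equipartition_exists (R : realType) (A : comNzRingType) (n d k : nat)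
    (x : 'I_n.+1 -> A) : 2%:R = 0 :> A ->
  ~ in_ideal (fun i => x i ^+ d)
    (\prod_(c | @tested k n c) lin_form x (test_char c)) ->
  forall mu : {measure set (borel_rV R d) -> \bar R}, mass_distribution mu ->
  exists (P : 'I_(2 * k) -> hyperplane R d) (H : 'I_n -> hyperplane R d),
    [/\ parallel_collection P,
        forall i j, ~ parallel (H i) (P j),
        forall i j, i != j -> ~ parallel (H i) (H j)
      & equipartition mu P H].
Proof.
move=> ch xI mu mu_mass.
pose D := [set c | @tested k n c]%SET.
pose chi (c : 'I_#|D|) := test_char (enum_val c).
have [|||u [u0 uz]] := @ideal_borsuk_ulam R _ n.+1 d #|D| x chi
  (fun c u => test mu (enum_val c) u) ch.
- have -> : \prod_(c < #|D|) lin_form x (chi c) =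
      \prod_(c in D) lin_form x (test_char c) by rewrite [RHS]big_enum_val.
  by rewrite (eq_bigl (@tested k n)); [exact: xI|move=> c; rewrite inE].
- move=> c U y U0 Uy.
  exact: (@test_cvg _ _ mu mu_mass k n _ (nbhs y) _ U (U y) (enum_val c) U0 Uy).
- by move=> c i u u0; apply: (test_negate mu_mass).
have cz : forall (j : 'I_(2 * k).+1) a, a != finset.set0 -> coef mu j a u = 0.
  apply: (test_zero mu_mass u0) => c ct; have cD : c \in D by rewrite inE.
  by have := uz (enum_rank_in cD c); rewrite enum_rankK_in.
have bm j s := bmass_eq mu_mass s u0 (cz j).
exists (@cuts R d mu k n u u0), (@bisectors R d mu n u u0); split.
- exact: cuts_collection.
- by move=> i j; apply: (bisector_cut_not_parallel mu_mass bm).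
- by move=> i j; apply: (bisectors_not_parallel mu_mass bm).
- exact: equipartition_bmass.
Qed.

Theorem theorem5p1 (R : realType) (m d k : nat) (hm : (2 <= m)%N)
    (hd : (1 <= d)%N) :
  let x1 : 'I_m := Ordinal (ltnW hm) in
  ~ in_ideal (fun i : 'I_m => var i ^+ d)
      (exact_quo (dickson (fun i : 'I_m.-1 => var (lift x1 i)))
                 (\prod_(i < m.-1) var (lift x1 i))
       * exact_quo (dickson (fun i : 'I_m => var i)) (var x1) ^+ k) ->
  forall mu : {measure set (borel_rV R d) -> \bar R},
    mass_distribution mu ->
    exists (P : 'I_(2 * k) -> hyperplane R d)
           (H : 'I_m.-1 -> hyperplane R d),
      [/\ parallel_collection P,
          forall i j, ~ parallel (H i) (P j),
          forall i j, i != j -> ~ parallel (H i) (H j)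
        & equipartition mu P H].
Proof.
case: m hm => // n hm x1 xI mu mu_mass.
(* As [x1] is the first index, [lift x1] enumerates the variables x_2, ..., x_m. *)
have x10 : x1 = ord0 by apply/val_inj.
rewrite {}x10 in xI.
have ch := F2_mpoly_char2 n.+1.
apply: (@equipartition_exists R _ n d k (@var n.+1) ch _ mu mu_mass).
(* Both quotients are evaluated from factorizations into linear forms, and their product becomes
   that of the forms of the test functions. *)
apply: contra_not xI; rewrite (prod_tested k (@var n.+1)).
rewrite (dickson_lift ch (@var n.+1) ord0) exact_quo_unique ?var_neq0//.
rewrite (dickson_vars ch) exact_quo_unique//.
by apply/prodf_neq0 => i _; exact: var_neq0.
Qed.
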